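(* Let $\alpha>-1$, $b\ge0$ and $1<p<\infty$ be such that $\alpha+2<p(b+1)$. Then $$\|\mathcal{H}_b\|_{A_\alpha^p\to A_\alpha^p}\ge B\Big(\frac{\alpha+2}{p},\,b+1-\frac{\alpha+2}{p}\Big).$$
   Context: $\mathbb{D}$ is the open unit disk in $\mathbb{C}$ and $dA$ is the normalized area measure on $\mathbb{D}$. For $0<p<\infty$ and $\alpha>-1$, the weighted Bergman space $A_\alpha^p$ is the space of analytic functions $f$ on $\mathbb{D}$ with $\|f\|_{A_\alpha^p}^p=(\alpha+1)\int_{\mathbb{D}}|f(z)|^p(1-|z|^2)^\alpha\,dA(z)<\infty$; $\|T\|_{A_\alpha^p\to A_\alpha^p}$ denotes the operator norm. For $b\ge0$ the generalized Hilbert operator $\mathcal{H}_b$ is defined on $f(z)=\sum_{k\ge0}a_kz^k$ by $$\mathcal{H}_b(f)(z)=\sum_{n=0}^\infty\Big(\sum_{k=0}^\infty\frac{\Gamma(n+b+1)\Gamma(n+k+1)}{\Gamma(n+1)\Gamma(n+k+b+2)}a_k\Big)z^n;$$ when $1<p<\infty$, $\alpha+2<p(b+1)$ and $f\in A_\alpha^p$, this is well defined and equals $\int_0^1\frac{f(t)(1-t)^b}{(1-tz)^{b+1}}\,dt$ for $z\in\mathbb{D}$. $B(s,t)=\int_0^1x^{s-1}(1-x)^{t-1}dx$ is the Beta function. *)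

(* Defs.v *)
From HB Require Import structures.
From mathcomp Require Import all_boot all_order all_algebra.
From mathcomp Require Import complex.
From mathcomp Require Import all_classical all_reals all_analysis.

Set Implicit Arguments.
Unset Strict Implicit.
Unset Printing Implicit Defensive.

Import Order.TTheory GRing.Theory Num.Theory.
Import numFieldNormedType.Exports.

Local Open Scope classical_set_scope.
Local Open Scope ring_scope.
Local Open Scope complex_scope.

Section special_functions.
Context {R : realType}.

Definition Gamma (x : R) : R :=
  \int[lebesgue_measure]_(t in `]0, +oo[) (t `^ (x - 1) * expR (- t)).

Definition Beta (s t : R) : R :=
  \int[lebesgue_measure]_(x in `]0, 1[) (x `^ (s - 1) * (1 - x) `^ (t - 1)).

End special_functions.

Section bergman.
Context {R : realType}.

(* [`|z|] is a complex number; [normc z] is the same modulus as an element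
   of [R]. *)
Local Notation normc := ComplexField.Normc.normc.

Definition unit_disk : set R[i] := [set z | normc z < 1].

(* Complex differentiability at every point of the disk. *)
Definition analytic_on_disk (f : R[i] -> R[i]) : Prop :=
  forall z, unit_disk z -> derivable (f : R[i]^o -> R[i]^o) z 1.

(* Area is Lebesgue measure on R * R, the point (x, y) standing for x + iy;
   dividing by pi gives the disk mass 1. The value may be +oo. *)
Definition disk_integral (g : R[i] -> R) : \bar R :=
  ((pi^-1)%:E * \int[lebesgue_measure \x lebesgue_measure]_(u in
      [set u : R * R | unit_disk (u.1 +i* u.2)]) (g (u.1 +i* u.2))%:E)%E.

Definition bergman_norm (alpha p : R) (f : R[i] -> R[i]) : \bar R :=
  (((alpha + 1)%:E * disk_integral
      (fun z => normc (f z) `^ p * (1 - normc z ^+ 2) `^ alpha)%R) `^ p^-1)%E.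

(* Functions are total on R[i]; only their values on the disk matter. *)
Definition bergman_space (alpha p : R) : set (R[i] -> R[i]) :=
  [set f | analytic_on_disk f /\ (bergman_norm alpha p f < +oo)%E].

(* Operator norm on the Bergman space, +oo for an unbounded operator. *)
Definition bergman_opnorm (alpha p : R) (T : (R[i] -> R[i]) -> R[i] -> R[i])
    : \bar R :=
  ereal_sup [set bergman_norm alpha p (T f) | f in
    [set f | bergman_space alpha p f /\ (bergman_norm alpha p f <= 1)%E]].

Definition is_power_series (f : R[i] -> R[i]) (a : nat -> R[i]^o) : Prop :=
  forall z, unit_disk z ->
    (series (fun k => a k * z ^+ k) : nat -> R[i]^o) @ \oo --> (f z : R[i]^o).

(* The sequence of coefficients of f; it exists and is unique for f analytic
   on the disk. *)
Definition coefs (f : R[i] -> R[i]) : nat -> R[i]^o :=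
  get [set a | is_power_series f a].

Definition hilbert_weight (b : R) (n k : nat) : R :=
  (Gamma (n%:R + b + 1) * Gamma (n%:R + k%:R + 1)) /
  (Gamma (n%:R + 1) * Gamma (n%:R + k%:R + b + 2)).

Definition csum (u : nat -> R[i]) : R[i] := limn (series (u : nat -> R[i]^o)).

Definition hilbert_op (b : R) (f : R[i] -> R[i]) (z : R[i]) : R[i] :=
  csum (fun n => csum (fun k => (hilbert_weight b n k)%:C * coefs f k) * z ^+ n).

End bergman.

(* Main.v *)
(* Idea: put s = (alpha + 2) / p and test the operator on f = (1 - z)^(-g) with
   g < s tending to s.  By Gauss's summation formula the n-th coefficient of
   H_b f is that of f times B(g, b + 1 - g) times B(n + 1, t) / B(n + g, t),
   where t = b + 1 - g.  The last ratio is 1 + O(1 / n) uniformly in g, so that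
   H_b f = B(g, b + 1 - g) f + O((1 - |z|)^(-d)) for a d > 0 with s - 1 <= d and
   d p < alpha + 1, and such an error has bounded norm while the norm of f blows
   up as g tends to s. *)

Require Import Defs.
From mathcomp Require Import all_boot all_order all_algebra.
From mathcomp Require Import complex.
From mathcomp Require Import all_classical all_reals all_analysis.
From mathcomp Require Import measurable_realfun ring lra zify.

Set Implicit Arguments.
Unset Strict Implicit.
Unset Printing Implicit Defensive.

Import Order.TTheory GRing.Theory Num.Theory.
Import numFieldNormedType.Exports.

Local Open Scope classical_set_scope.
Local Open Scope ring_scope.
Local Open Scope complex_scope.

Local Notation normc := (@ComplexField.Normc.normc _).
Local Notation Re := (@complex.Re _).
Local Notation Im := (@complex.Im _).

(** * Sequences and series of complex numbers *)

Section complex_sequences.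
Context {R : realType}.
Implicit Types (z w : R[i]) (u v : nat -> R[i]).

(** The error series is summed in absolute value, so only |z| survives: (1 - |z|)^(-d) is
    p-integrable against the weight for d p < alpha + 1 only, whereas |1 - z|^(-g) is allowed g p <
    alpha + 2. The gained factor 1 / n pays for this, since it lowers the exponent by one and (s -
    1) p = alpha + 2 - p is below alpha + 1 exactly because p > 1; this leaves room for [d]. Complex
    powers never occur: (1 - z)^(-g) is its Taylor series, and only its modulus is needed, which a
    conserved quantity along rays supplies. The blow-up of its norm is read off a triangle with
    vertex 1, where the integral is at least c / (alpha + 2 - g p). The constants in the error do
    not depend on [g], so the passage to the limit becomes a single choice of [g] for each tolerance
    [e]. *)

Lemma normr_normc z : `|z| = (normc z)%:C.
Proof. by case: z => x y; rewrite normc_def. Qed.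

Lemma normc_ge0 z : 0 <= normc z.
Proof. by case: z => x y; rewrite /= sqrtr_ge0. Qed.

Lemma normc_real (x : R) : normc x%:C = `|x|.
Proof. by rewrite /= expr0n /= addr0 sqrtr_sqr. Qed.

Lemma normcX z n : normc (z ^+ n) = normc z ^+ n.
Proof.
by elim: n => [|n ih]; rewrite ?expr0 ?ComplexField.Normc.normc1// !exprS ComplexField.Normc.normcM ih.
Qed.

Lemma le_normc_sub z w : `|normc z - normc w| <= normc (z - w).
Proof.
have h (a b : R[i]) : normc a - normc b <= normc (a - b).
  by rewrite lerBlDr (le_trans _ (le_normcD _ _))// subrK.
rewrite ler_norml h andbT lerNl opprB (le_trans (h _ _))//.
by rewrite -normcN opprB.
Qed.

Lemma le_Re_normc z : `|Re z| <= normc z.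
Proof. by have := normc_ge_Re z; rewrite normr_normc lecR. Qed.

Lemma normc_le_ReIm z : normc z <= `|Re z| + `|Im z|.
Proof.
case: z => x y /=; rewrite -[leRHS]ger0_norm ?addr_ge0// -[leRHS]sqrtr_sqr.
rewrite ler_sqrt ?sqr_ge0// sqrrD !real_normK ?num_real//.
by rewrite lerD2r lerDl mulrn_wge0// mulr_ge0.
Qed.

(** The norm of [R[i]] takes its values in [R[i]], so the tolerances in its topology are complex. A
    positive complex number is real, which brings convergence back to a real sequence. *)
Lemma cvgC_dist u (l : R[i]) :
  (u : nat -> R[i]^o) @ \oo --> (l : R[i]^o) <->
  normc (l - u n) @[n --> \oo] --> (0 : R).
Proof.
split=> [/cvgrPdist_lt h|/cvgrPdist_lt h].
- apply/cvgrPdist_lt => e e0.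
  have e0' : 0 < e%:C :> R[i] by rewrite ltcR.
  have := h _ e0'; apply: filterS => n.
  by rewrite sub0r normrN (ger0_norm (normc_ge0 _)) normr_normc ltcR.
- apply/cvgrPdist_lt => e; rewrite ltcE => /andP[/eqP/= e1 e0].
  have := h _ e0; apply: filterS => n.
  rewrite sub0r normrN (ger0_norm (normc_ge0 _)) normr_normc.
  by rewrite -ltcR [in X in _ -> X](_ : e = (Re e)%:C)//; case: e e1 {e0} => a b /= ->.
Qed.

Lemma cvgC_normc u (l : R[i]) :
  (u : nat -> R[i]^o) @ \oo --> (l : R[i]^o) ->
  normc (u n) @[n --> \oo] --> normc l.
Proof.
move=> /cvgC_dist h; apply: cvg_sub0 (cvg_cst (normc l)) => //=.
apply: (@squeeze_cvgr _ _ _ _ (fun n => - normc (l - u n)) (fun n => normc (l - u n))).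
- near=> n; rewrite -ler_norml !fctE (le_trans (le_normc_sub _ _))//.
  by rewrite -normcN opprB.
- by rewrite -oppr0; apply: cvgN.
- exact: h.
Unshelve. all: by end_near. Qed.

Lemma cvgC_real (u : nat -> R) (l : R) :
  u @ \oo --> l -> ((fun n => (u n)%:C) : nat -> R[i]^o) @ \oo --> (l%:C : R[i]^o).
Proof.
move=> h; apply/cvgC_dist.
have -> : (fun n => normc (l%:C - (u n)%:C)) = (fun n => `|l - u n|).
  by apply/funext => n; rewrite -rmorphB normc_real.
rewrite -(normr0 R^o); apply: cvg_norm.
by rewrite -(subrr l); apply: cvgB => //; apply: cvg_cst.
Qed.

Lemma cvgC_ReIm u (a b : R) :
  Re (u n) @[n --> \oo] --> a -> Im (u n) @[n --> \oo] --> b ->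
  (u : nat -> R[i]^o) @ \oo --> (a +i* b : R[i]^o).
Proof.
move=> ha hb; apply/cvgC_dist.
have h0 : `|a - Re (u n)| + `|b - Im (u n)| @[n --> \oo] --> (0 : R).
  rewrite -(addr0 0) -(normr0 R^o); apply: cvgD; apply: cvg_norm.
    by rewrite -(subrr a); apply: cvgB => //; apply: cvg_cst.
  by rewrite -(subrr b); apply: cvgB => //; apply: cvg_cst.
apply: squeeze_cvgr h0; last exact: cvg_cst.
near=> n; rewrite normc_ge0 (le_trans (normc_le_ReIm _))//=.
by case: (u n).
Unshelve. all: by end_near. Qed.

End complex_sequences.

(** * Absolutely convergent complex series and coefficients of tame growth *)

Section complex_series.
Context {R : realType}.
Implicit Types (z w : R[i]) (u v : nat -> R[i]) (c d : nat -> R).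

Lemma Re_sum I (s : seq I) (f : I -> R[i]) :
  Re (\sum_(i <- s) f i) = \sum_(i <- s) Re (f i).
Proof.
elim: s => [|a s ih]; rewrite ?big_nil// !big_cons -ih.
by case: (f a) => ? ?; case: (\sum_(_ <- _) _).
Qed.

Lemma Im_sum I (s : seq I) (f : I -> R[i]) :
  Im (\sum_(i <- s) f i) = \sum_(i <- s) Im (f i).
Proof.
elim: s => [|a s ih]; rewrite ?big_nil// !big_cons -ih.
by case: (f a) => ? ?; case: (\sum_(_ <- _) _).
Qed.

Lemma le_Im_normc z : `|Im z| <= normc z.
Proof.
case: z => x y /=; rewrite -[leLHS]sqrtr_sqr ler_sqrt ?addr_ge0 ?sqr_ge0//.
by rewrite lerDr sqr_ge0.
Qed.

Lemma csum_unique u (l : R[i]) :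
  (series (u : nat -> R[i]^o)) @ \oo --> (l : R[i]^o) -> csum u = l.
Proof. by move=> h; apply: (@cvg_lim R[i]^o) h => //; exact: norm_hausdorff. Qed.

Lemma bounded_cvgn_series (u : nat -> R) (M : R) : (forall k, 0 <= u k) ->
  (forall n, series u n <= M) -> cvgn (series u).
Proof.
move=> u0 uM; apply: nondecreasing_is_cvgn.
  by apply/nondecreasing_seqP => n; rewrite /series/= big_nat_recr//= lerDl.
by exists M => _ [n _ <-].
Qed.

(** Bounded sums of moduli dominate the real and the imaginary parts separately, and each of these
    real series converges by comparison. *)
Lemma cvg_csum u (M : R) : (forall n, series (normc \o u) n <= M) ->
  (series (u : nat -> R[i]^o)) @ \oo --> (csum u : R[i]^o).
Proof.
move=> uM; have cu : cvgn (series (normc \o u)).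
  by apply: (bounded_cvgn_series _ uM) => k; apply: normc_ge0.
have cRe : cvgn (series (Re \o u)).
  apply: normed_cvg; apply: series_le_cvg cu => //= k.
    exact: normc_ge0.
  exact: le_Re_normc.
have cIm : cvgn (series (Im \o u)).
  apply: normed_cvg; apply: series_le_cvg cu => //= k.
    exact: normc_ge0.
  exact: le_Im_normc.
have h : (series (u : nat -> R[i]^o)) @ \oo -->
  (limn (series (Re \o u)) +i* limn (series (Im \o u)) : R[i]^o).
  apply: cvgC_ReIm.
    have -> : (fun n => Re (series (u : nat -> R[i]^o) n)) = series (Re \o u).
      by apply/funext => n; rewrite /series/= Re_sum.
    exact: cRe.
  have -> : (fun n => Im (series (u : nat -> R[i]^o) n)) = series (Im \o u).
    by apply/funext => n; rewrite /series/= Im_sum.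
  exact: cIm.
by rewrite (csum_unique h).
Qed.

Lemma normc_sum I (s : seq I) (f : I -> R[i]) :
  normc (\sum_(i <- s) f i) <= \sum_(i <- s) normc (f i).
Proof.
elim: s => [|a s ih]; first by rewrite !big_nil ComplexField.Normc.normc0.
by rewrite !big_cons (le_trans (le_normcD _ _))// lerD2l.
Qed.

Lemma normc_lim_le (u : nat -> R[i]) (l : R[i]) (M : R) :
  (u : nat -> R[i]^o) @ \oo --> (l : R[i]^o) -> (forall n, normc (u n) <= M) ->
  normc l <= M.
Proof.
move=> /cvgC_normc h hM.
rewrite -(cvg_lim (@Rhausdorff R) h); apply: limr_le; first by apply/cvg_ex; exists (normc l).
by near=> n.
Unshelve. all: by end_near. Qed.

Lemma csum_ub u (M : R) : (forall n, series (normc \o u) n <= M) ->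
  normc (csum u) <= M.
Proof.
move=> uM; apply: normc_lim_le (cvg_csum uM) _ => n.
by rewrite (le_trans (normc_sum _ _))//; apply: uM.
Qed.

(* The power series with coefficients [c] has radius of convergence at least 1. *)
Definition tame c := forall r : R, 0 < r < 1 ->
  exists M : R, forall k, `|c k| * r ^+ k <= M.

Definition pws c z : R[i] := csum (fun k => (c k)%:C * z ^+ k).

Lemma geometric_sum_le (q : R) n : 0 <= q < 1 ->
  \sum_(0 <= k < n) q ^+ k <= (1 - q)^-1.
Proof.
move=> /andP[q0 q1]; have q1' : 0 < 1 - q by rewrite subr_gt0.
have -> : \sum_(0 <= k < n) q ^+ k = (1 - q ^+ n) / (1 - q).
  have := @geometric_seriesE R 1 q; rewrite lt_eqF// => /(_ isT).
  move=> /(congr1 (@^~ n)); rewrite /series/= /geometric/= mul1r => <-.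
  by apply: eq_bigr => i _; rewrite mul1r.
by rewrite ler_pdivrMr// mulVf ?gt_eqF// gerBl exprn_ge0.
Qed.

(** At the midpoint [q] of [r] and 1 the terms are bounded, so at [r] they are dominated by a
    geometric series of ratio [r / q]. *)
Lemma tame_sum c (r : R) : tame c -> 0 <= r < 1 ->
  exists M : R, forall n, \sum_(0 <= k < n) `|c k| * r ^+ k <= M.
Proof.
move=> tc /andP[r0 r1]; pose q := (1 + r) / 2.
have q0 : 0 < q by rewrite /q; lra.
have q1 : q < 1 by rewrite /q; lra.
have rq : r < q by rewrite /q; lra.
have [M hM] := tc q ltac:(by rewrite q0 q1).
have M0 : 0 <= M by rewrite (le_trans _ (hM 0))// mulr_ge0// exprn_ge0// ltW.
have rq01 : 0 <= r / q < 1.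
  by rewrite divr_ge0//= ?(ltW q0)// ltr_pdivrMr// mul1r.
exists (M / (1 - r / q)) => n.
rewrite (@le_trans _ _ (\sum_(0 <= k < n) M * (r / q) ^+ k))//.
  apply: ler_sum => k _.
  rewrite expr_div_n mulrA ler_pdivlMr ?exprn_gt0// mulrAC.
  by rewrite ler_wpM2r ?exprn_ge0.
by rewrite -mulr_sumr ler_wpM2l// geometric_sum_le.
Qed.

(** Each of the [k] powers q^i with i < k is at least q^k, so k q^k is below a partial geometric
    sum. *)
Lemma natr_geometric_le (q : R) k : 0 <= q < 1 -> k%:R * q ^+ k <= (1 - q)^-1.
Proof.
move=> q01; apply: le_trans (geometric_sum_le k q01).
have /andP[q0 q1] := q01.
rewrite mulr_natl -[X in _ *+ X]subn0 -sumr_const_nat.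
apply: ler_sum_nat => i /andP[_ ik].
by apply: ler_wiXn2l => //; [exact: ltW | exact: ltnW].
Qed.

Lemma tame_le c d (C : R) : tame c -> (forall k, `|d k| <= C * `|c k|) -> tame d.
Proof.
move=> tc h r r01; have [M hM] := tc r r01; exists (`|C| * M) => k.
have /andP[r0 _] := r01.
rewrite (@le_trans _ _ (`|C| * (`|c k| * r ^+ k)))//; last by rewrite ler_wpM2l.
rewrite mulrA ler_wpM2r ?exprn_ge0 ?(ltW r0)// (le_trans (h k))// ler_wpM2r//.
exact: ler_norm.
Qed.

Lemma tameD c d : tame c -> tame d -> tame (fun k => c k + d k).
Proof.
move=> tc td r r01; have [M hM] := tc r r01; have [N hN] := td r r01.
exists (M + N) => k; have /andP[r0 _] := r01.
rewrite (@le_trans _ _ (`|c k| * r ^+ k + `|d k| * r ^+ k))//; last exact: lerD.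
by rewrite -mulrDl ler_wpM2r ?ler_normD// exprn_ge0// ltW.
Qed.

(** The factor [k] is absorbed by moving from [r] to the midpoint [q], because k (r / q)^k is
    bounded. *)
Lemma tame_natr c : tame c -> tame (fun k => k%:R * c k).
Proof.
move=> tc r /andP[r0 r1]; pose q := (1 + r) / 2.
have q0 : 0 < q by rewrite /q; lra.
have q1 : q < 1 by rewrite /q; lra.
have rq : r < q by rewrite /q; lra.
have [M hM] := tc q ltac:(by rewrite q0 q1).
have M0 : 0 <= M by rewrite (le_trans _ (hM 0))// mulr_ge0// exprn_ge0// ltW.
have rq01 : 0 <= r / q < 1.
  by rewrite divr_ge0//= ?(ltW q0) ?(ltW r0)// ltr_pdivrMr// mul1r.
exists (M * (1 - r / q)^-1) => k.
have -> : `|k%:R * c k| * r ^+ k = (`|c k| * q ^+ k) * (k%:R * (r / q) ^+ k).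
  rewrite normrM normr_nat (expr_div_n r q).
  have qk0 : q ^+ k != 0 by rewrite expf_neq0// gt_eqF.
  by move: (q ^+ k) (r ^+ k) qk0 => x y x0; field.
rewrite ler_pM// ?natr_geometric_le//.
  by rewrite mulr_ge0 ?exprn_ge0// ltW.
by rewrite mulr_ge0 ?exprn_ge0// ?(andP rq01).1//; case/andP: rq01.
Qed.

Lemma tame_shift c : tame c -> tame (fun k => c k.+1).
Proof.
move=> tc r r01; have [M hM] := tc r r01; have /andP[r0 _] := r01.
exists (M / r) => k; rewrite ler_pdivlMr// -mulrA -exprSr; exact: hM.
Qed.

Lemma cvg_pws c z : tame c -> normc z < 1 ->
  (series (fun k => (c k)%:C * z ^+ k : R[i]^o)) @ \oo --> (pws c z : R[i]^o).
Proof.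
move=> tc z1; have [|M hM] := tame_sum (r := normc z) tc; first by rewrite normc_ge0.
apply: (@cvg_csum _ M) => n; rewrite (le_trans _ (hM n))// ler_sum// => k _ /=.
by rewrite ComplexField.Normc.normcM normc_real normcX.
Qed.

Lemma normc_pws_le c z (M : R) :
  (forall n, \sum_(0 <= k < n) `|c k| * normc z ^+ k <= M) ->
  normc (pws c z) <= M.
Proof.
move=> hM; apply: csum_ub => n; rewrite (le_trans _ (hM n))// ler_sum// => k _ /=.
by rewrite ComplexField.Normc.normcM normc_real normcX.
Qed.

Lemma pwsD c d z : tame c -> tame d -> normc z < 1 ->
  pws (fun k => c k + d k) z = pws c z + pws d z.
Proof.
move=> tc td z1; apply: csum_unique.
rewrite (_ : series _ = (series (fun k => (c k)%:C * z ^+ k : R[i]^o) +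
  series (fun k => (d k)%:C * z ^+ k : R[i]^o))); last first.
  apply/funext => n; rewrite /series/= fctE -big_split/=.
  by apply: eq_bigr => k _; rewrite rmorphD mulrDl.
by apply: cvgD; apply: cvg_pws.
Qed.

Lemma pwsZ c (k : R) z : tame c -> normc z < 1 ->
  pws (fun n => k * c n) z = k%:C * pws c z.
Proof.
move=> tc z1; apply: csum_unique.
rewrite (_ : series _ = (fun n => (k%:C : R[i]) *:
  series (fun k => (c k)%:C * z ^+ k : R[i]^o) n)); last first.
  apply/funext => n; rewrite /series/= scaler_sumr.
  by apply: eq_bigr => i _; rewrite rmorphM -mulrA.
by apply: cvgZr; apply: cvg_pws.
Qed.

End complex_series.

(** * Power series with real coefficients *)

(** Stated over any [numFieldType] because it serves twice: for complex derivatives of power series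
    and for real derivatives along a ray of the disk. *)
Lemma is_derive_quadratic (K : numFieldType) (f : K^o -> K^o) (x d M e : K) :
  0 < e -> 0 <= M ->
  (forall h, `|h| < e -> `|f (x + h) - f x - h * d| <= M * `|h| ^+ 2) ->
  is_derive (x : K^o) (1 : K^o) f d.
Proof.
move=> e0 M0 hf.
have h : h^-1 *: (f (h *: (1 : K^o) + x) - f x) @[h --> (0 : K)^'] --> (d : K^o).
  apply/cvgrPdist_lt => eps eps0; near=> h.
  have h0 : h != 0 by near: h; exact: nbhs_dnbhs_neq.
  have -> : d - h^-1 *: (f (h *: (1 : K^o) + x) - f x) =
      - (h^-1 * (f (x + h) - f x - h * d)).
    by rewrite /GRing.scale/= mulr1 (addrC h); field.
  rewrite normrN normrM normfV mulrC ltr_pdivrMr ?normr_gt0//.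
  have he : `|h| < e.
    near: h; apply: dnbhs0_lt => //.
  rewrite (le_lt_trans (hf _ he))// expr2 mulrA ltr_pM2r ?normr_gt0//.
  have : `|h| < eps / (M + 1).
    by near: h; apply: dnbhs0_lt => //; rewrite divr_gt0// ltr_wpDl.
  rewrite ltr_pdivlMr ?ltr_wpDl// => /(le_lt_trans _); apply.
  by rewrite mulrC ler_wpM2l// lerDl.
constructor; first by apply/cvg_ex; exists d.
by rewrite /derive; apply: cvg_lim => //; exact: norm_hausdorff.
Unshelve. all: by end_near. Qed.

Section power_series.
Context {R : realType}.
Implicit Types (z w h : R[i]) (c d : nat -> R).

Definition pws_diff c : nat -> R := fun k => k.+1%:R * c k.+1.

Lemma tame_diff c : tame c -> tame (pws_diff c).
Proof. by move=> /tame_natr/tame_shift. Qed.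

(** The remainder for [k.+1] is (z + h) times the remainder for [k] plus h^2 k z^(k-1), and k^2 + k
    <= (k + 1)^2 closes the induction. The factor [r ^+ 2] on the left avoids an exponent k - 2. *)
Lemma taylor1_pow_le z h (r : R) k : normc z <= r -> normc (z + h) <= r ->
  normc ((z + h) ^+ k - z ^+ k - h * (k%:R * z ^+ k.-1)) * r ^+ 2 <=
  k%:R ^+ 2 * r ^+ k * normc h ^+ 2.
Proof.
move=> zr zhr; have r0 : 0 <= r by rewrite (le_trans _ zr)// normc_ge0.
elim: k => [|k ih].
  by rewrite !expr0 subrr mul0r mulr0 subr0 ComplexField.Normc.normc0 expr0n/= !mul0r.
have -> : (z + h) ^+ k.+1 - z ^+ k.+1 - h * (k.+1%:R * z ^+ k.+1.-1) =
  (z + h) * ((z + h) ^+ k - z ^+ k - h * (k%:R * z ^+ k.-1)) + h ^+ 2 * (k%:R * z ^+ k.-1).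
  case: k {ih} => [|k] /=; first by rewrite !expr1 !expr0; ring.
  by rewrite !exprS -[in RHS]natr1 -!natr1; ring.
rewrite (@le_trans _ _ (r * (k%:R ^+ 2 * r ^+ k * normc h ^+ 2) + normc h ^+ 2 * (k%:R * r ^+ k.+1)))//.
  apply: le_trans (ler_wpM2r _ (le_normcD _ _)) _; first exact: exprn_ge0.
  rewrite mulrDl lerD//.
    rewrite ComplexField.Normc.normcM -[leLHS]mulrA; apply: ler_pM; [exact: normc_ge0| |by []|exact: ih].
    by apply: mulr_ge0; [exact: normc_ge0|exact: exprn_ge0].
  rewrite !ComplexField.Normc.normcM -!mulrA normcX ler_wpM2l ?exprn_ge0 ?normc_ge0//.
  have -> : normc (k%:R : R[i]) = k%:R.
    by rewrite -(rmorph_nat (real_complex R)) normc_real ger0_norm.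
  rewrite ler_wpM2l ?normc_ge0//; case: k {ih} => [|k] /=; first by rewrite !mul0r.
  rewrite ler_wpM2l//. rewrite -[k.+2]addn2 exprD ler_wpM2r ?exprn_ge0//.
  by apply: lerXn2r => //; rewrite nnegrE normc_ge0.
rewrite (_ : _ + _ = (k%:R ^+ 2 + k%:R) * r ^+ k.+1 * normc h ^+ 2); last by rewrite (exprS r k); ring.
rewrite ler_wpM2r ?exprn_ge0 ?normc_ge0// ler_wpM2r ?exprn_ge0//.
by rewrite -natr1; have := ler0n R k; nra.
Qed.

Lemma cvg_pws_diff c z : tame c -> normc z < 1 ->
  (series (fun k => (c k)%:C * (k%:R * z ^+ k.-1) : R[i]^o)) @ \oo -->
  (pws (pws_diff c) z : R[i]^o).
Proof.
move=> tc z1; rewrite -cvg_shiftS.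
have := cvg_pws (tame_diff tc) z1.
rewrite (_ : series _ = (fun n => series (fun k => (c k)%:C * (k%:R * z ^+ k.-1) : R[i]^o) n.+1))//.
apply/funext => n; rewrite /series/= big_nat_recl//= mul0r mulr0 add0r.
apply: eq_bigr => k _; rewrite /pws_diff rmorphM/= (rmorph_nat (real_complex R)).
by rewrite mulrA (mulrC _%:R).
Qed.

(** For small [h] both points stay in the disk of radius [r], the midpoint of |z| and 1. The
    termwise remainders then sum to at most a multiple of the series of k^2 |c k| r^k, finite by two
    uses of [tame_natr]. *)
Lemma pws_quadratic c z : tame c -> normc z < 1 -> exists2 M : R, 0 <= M &
  forall h, normc h < (1 - normc z) / 2 ->
  normc (pws c (z + h) - pws c z - h * pws (pws_diff c) z) <= M * normc h ^+ 2.
Proof.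
move=> tc z1; pose r := (1 + normc z) / 2.
have z0 := normc_ge0 z.
have r0 : 0 < r by rewrite /r; lra.
have r1 : r < 1 by rewrite /r; lra.
have zr : normc z <= r by rewrite /r; lra.
have r01 : 0 <= r < 1 by rewrite r1 ltW.
have [M hM] := tame_sum (tame_natr (tame_natr tc)) r01.
exists (M / r ^+ 2).
  by rewrite divr_ge0 ?exprn_ge0 ?(ltW r0)//; have := hM 0; rewrite big_nil.
move=> h hh; have zhr : normc (z + h) <= r.
  rewrite (le_trans (le_normcD _ _))//; rewrite /r; lra.
pose u k := (c k)%:C * ((z + h) ^+ k - z ^+ k - h * (k%:R * z ^+ k.-1)).
have cu : (series (u : nat -> R[i]^o)) @ \oo -->
    (pws c (z + h) - pws c z - h * pws (pws_diff c) z : R[i]^o).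
  have -> : series (u : nat -> R[i]^o) = (fun n =>
    series (fun k => (c k)%:C * (z + h) ^+ k : R[i]^o) n -
    series (fun k => (c k)%:C * z ^+ k : R[i]^o) n -
    (h : R[i]) *: series (fun k => (c k)%:C * (k%:R * z ^+ k.-1) : R[i]^o) n).
    apply/funext => n; rewrite /series/= scaler_sumr -!sumrB.
    apply: eq_bigr => k _; rewrite /u /GRing.scale/= !mulrBr.
    by congr (_ - _); rewrite mulrCA.
  apply: cvgB; last by apply: cvgZr; apply: cvg_pws_diff.
  by apply: cvgB; apply: cvg_pws => //; rewrite (le_lt_trans zhr).
apply: normc_lim_le cu _ => n.
rewrite (le_trans (normc_sum _ _))//.
have r20 : 0 < r ^+ 2 by rewrite exprn_gt0.
rewrite -(ler_pM2r r20) mulr_suml mulrAC divfK ?gt_eqF// .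
apply: le_trans (ler_wpM2r _ (hM n)); last by rewrite exprn_ge0// normc_ge0.
rewrite mulr_suml; apply: ler_sum => k _.
rewrite /u ComplexField.Normc.normcM normc_real -[leLHS]mulrA.
apply: le_trans (ler_wpM2l (normr_ge0 (c k)) (taylor1_pow_le k zr zhr)) _.
by rewrite !normrM !normr_nat le_eqVlt; apply/orP; left; apply/eqP; ring.
Qed.

Lemma is_derive_pws c z : tame c -> normc z < 1 ->
  is_derive (z : R[i]^o) (1 : R[i]^o) (pws c : R[i]^o -> R[i]^o) (pws (pws_diff c) z).
Proof.
move=> tc z1; have [M M0 hM] := pws_quadratic tc z1.
apply: (@is_derive_quadratic _ _ _ _ M%:C ((1 - normc z) / 2)%:C).
- by rewrite ltcR; lra.
- by rewrite lecR.
- move=> h; rewrite !normr_normc ltcR -rmorphXn -rmorphM lecR; exact: hM.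
Qed.

(** [coefs] is obtained by choice, so it can be computed only through uniqueness. The argument is at
    the origin: the first nonzero coefficient of the difference would dominate the tail. *)
Lemma power_series_unique (f : R[i] -> R[i]) (a b : nat -> R[i]^o) :
  is_power_series f a -> is_power_series f b -> a = b.
Proof.
move=> fa fb; pose d k : R[i] := a k - b k.
have d0 z : normc z < 1 -> (series (fun k => d k * z ^+ k : R[i]^o)) @ \oo --> (0 : R[i]^o).
  move=> z1; rewrite -(subrr (f z)).
  have -> : series (fun k => d k * z ^+ k : R[i]^o) =
    (fun n => series (fun k => a k * z ^+ k : R[i]^o) n - series (fun k => b k * z ^+ k : R[i]^o) n).
    by apply/funext => n; rewrite /series/= -sumrB; apply: eq_bigr => k _; rewrite mulrBl.
  by apply: cvgB; [exact: fa|exact: fb].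
suff dk : forall k, d k = 0 by apply/funext => k; apply/eqP; rewrite -subr_eq0; apply/eqP; exact: dk.
have h2 : normc ((2^-1)%:C : R[i]) = 2^-1 by rewrite normc_real ger0_norm.
(* Convergence at the point 1/2 makes the terms bounded there. *)
have [M M0 hM] : exists2 M : R, 0 <= M & forall k, normc (d k) <= M * 2 ^+ k.
  have cd : cvgn (fun k => normc (d k * (2^-1)%:C ^+ k)).
    apply/cvg_ex; exists (normc (0 : R[i])).
    apply: cvgC_normc; apply: cvg_series_cvg_0; apply/cvg_ex; exists 0.
    by apply: d0; rewrite h2; lra.
  have [M [Mr hM]] := cvg_seq_bounded cd.
  exists (`|M| + 1) => [|k]; first by rewrite addr_ge0.
  have M1 : M < `|M| + 1 by rewrite (le_lt_trans (ler_norm _))// ltrDl.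
  have := hM _ M1 k I.
  rewrite /= ger0_norm ?normc_ge0// ComplexField.Normc.normcM normcX h2.
  by rewrite exprVn ler_pdivrMr// exprn_gt0.
elim/ltn_ind => m ih.
apply: ComplexField.Normc.eq0_normc; apply/eqP; rewrite eq_le normc_ge0 andbT.
(* The coefficients before [m] vanish by induction, so in the limit the m-th term cancels the tail.
   For [t <= 4^-1] the ratio 2 t is at most 1/2, so the geometric tail is at most twice its first
   term; letting [t] tend to 0 then kills [d m]. *)
have key (t : R) : 0 < t -> t <= 4^-1 -> normc (d m) <= M * 2 ^+ m.+2 * t.
  move=> t0 t4.
  have tm0 : 0 < t ^+ m by rewrite exprn_gt0.
  have t1 : normc (t%:C : R[i]) < 1 by rewrite normc_real gtr0_norm//; lra.
  rewrite -(ler_pM2r tm0).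
  have cS := cvgC_normc (d0 _ t1).
  rewrite -subr_le0 -[leRHS](@ComplexField.Normc.normc0 R).
  rewrite -(cvg_lim (@Rhausdorff R) cS); apply: limr_ge; first by apply/cvg_ex; eexists; exact: cS.
  near=> n.
  have mn : (m < n)%N by near: n; exact: nbhs_infty_gt.
  rewrite lerBlDr.
  have -> : series (fun k => d k * t%:C ^+ k : R[i]^o) n =
     d m * t%:C ^+ m + \sum_(m.+1 <= k < n) d k * t%:C ^+ k.
    rewrite /series/= (@big_cat_nat _ _ _ m)//=; last exact: ltnW.
    rewrite [X in X + _]big_nat_cond big1 ?add0r; last first.
      by move=> i /andP[/andP[_ im] _]; rewrite ih// mul0r.
    by rewrite big_ltn.
  have tail : normc (\sum_(m.+1 <= k < n) d k * t%:C ^+ k) <=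
      M * 2 ^+ m.+2 * t * t ^+ m.
    rewrite (le_trans (normc_sum _ _))//.
    rewrite (@le_trans _ _ (\sum_(m.+1 <= k < n) M * (2 * t) ^+ k))//.
      apply: ler_sum => k _.
      rewrite ComplexField.Normc.normcM normcX normc_real gtr0_norm// exprMn mulrA.
      by rewrite ler_wpM2r// exprn_ge0// ltW.
    rewrite -mulr_sumr -!mulrA ler_wpM2l// -{1}[m.+1]add0n big_addn.
    under eq_bigr do rewrite exprD.
    rewrite -mulr_suml.
    have /(geometric_sum_le (n - m.+1)) t2 : 0 <= 2 * t < 1 by lra.
    rewrite (@le_trans _ _ (2 * (2 * t) ^+ m.+1))//.
      rewrite ler_wpM2r ?exprn_ge0//; first by lra.
      rewrite (le_trans t2)// -[leRHS]invrK lef_pV2 ?posrE//; lra.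
    by rewrite exprMn -exprS mulrA -exprS.
  have := le_normcD (d m * t%:C ^+ m + \sum_(m.+1 <= k < n) d k * t%:C ^+ k)
    (- \sum_(m.+1 <= k < n) d k * t%:C ^+ k).
  rewrite addrK normcN ComplexField.Normc.normcM normcX normc_real gtr0_norm//.
  by move=> h; rewrite (le_trans h)// lerD2l.
apply/ler_addgt0Pr => e e0; rewrite add0r.
pose N := M * 2 ^+ m.+2 + 1.
have N0 : 0 < N by rewrite ltr_wpDl// mulr_ge0// exprn_ge0.
pose t := Num.min 4^-1 (e / N).
have t0 : 0 < t by rewrite lt_min divr_gt0// andbT invr_gt0.
rewrite (le_trans (key t t0 _)) ?ge_min ?lexx//.
rewrite (@le_trans _ _ (N * t))//; first by rewrite ler_wpM2r ?(ltW t0)// lerDl.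
by rewrite mulrC -ler_pdivlMr// ge_min lexx orbT.
Unshelve. all: by end_near. Qed.

End power_series.

(** * The binomial series *)

Section binomial_series.
Context {R : realType}.
Implicit Types (g x y t : R) (z w h : R[i]) (c d : nat -> R).

(* The Taylor coefficients of (1 - z)^(-g). *)
Definition binc g (k : nat) : R := \prod_(i < k) ((g + i%:R) / i.+1%:R).

Lemma binc0 g : binc g 0 = 1.
Proof. by rewrite /binc big_ord0. Qed.

Lemma bincS g k : binc g k.+1 = binc g k * ((g + k%:R) / k.+1%:R).
Proof. by rewrite /binc big_ord_recr. Qed.

Lemma binc_gt0 g k : 0 < g -> 0 < binc g k.
Proof.
by move=> g0; apply: prodr_gt0 => i _; rewrite divr_gt0// ltr_wpDr.
Qed.

Lemma binc_le g g' k : 0 < g -> g <= g' -> binc g k <= binc g' k.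
Proof.
move=> g0 gg; apply: ler_prod => i _; rewrite divr_ge0//=; last first.
  by rewrite addr_ge0// ltW.
by rewrite ler_wpM2r ?invr_ge0// lerD2r.
Qed.

(** Coefficientwise form of the rule that (1 - z)^(-g) has derivative g (1 - z)^(-g-1). *)
Lemma binc_shift g k : 0 < g -> binc (g + 1) k = (k%:R / g + 1) * binc g k.
Proof.
move=> g0; elim: k => [|k ih]; first by rewrite !binc0 mul0r add0r mul1r.
rewrite !bincS ih -!natr1; field.
by rewrite natr1 pnatr_eq0/= gt_eqF.
Qed.

(** For integer exponents this is an induction from the constant sequence [binc 1], by [binc_shift]
    and [tame_natr]. Any other [g] lies below an integer, and [binc] increases with the exponent. *)
Lemma tame_binc g : 0 < g -> tame (binc g).
Proof.
have h n : tame (binc n.+1%:R).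
  elim: n => [|n ih].
    move=> r /andP[r0 r1]; exists 1 => k.
    have -> : binc 1 k = 1.
      elim: k => [|k ih]; first exact: binc0.
      by rewrite bincS ih mul1r nat1r divff// pnatr_eq0.
    by rewrite normr1 mul1r exprn_ile1// ltW.
  apply: (tame_le (C := 1) (tameD (tame_natr ih) ih)) => k.
  rewrite mul1r -natr1 binc_shift ?ltr0n// mulrDl mul1r.
  rewrite !ger0_norm; try by rewrite addr_ge0 ?mulr_ge0 ?divr_ge0// ltW// binc_gt0 ?ltr0n.
  rewrite lerD2r ler_wpM2r ?(ltW (binc_gt0 _ _)) ?ltr0n// ler_pdivrMr ?ltr0n//.
  by rewrite ler_peMr// ler1n.
move=> g0; have [n gn] : exists n, g <= n.+1%:R.
  exists (Num.truncn g); apply: ltW; exact: truncnS_gt.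
apply: (tame_le (C := 1) (h n)) => k.
rewrite mul1r !gtr0_norm ?binc_gt0 ?ltr0n//; exact: binc_le.
Qed.

Lemma pws_diff_binc g k : pws_diff (binc g) k = g * binc g k + k%:R * binc g k.
Proof.
by rewrite /pws_diff bincS; field; rewrite nat1r pnatr_eq0.
Qed.

Lemma pws_Xdiff c z : tame c -> normc z < 1 ->
  z * pws (pws_diff c) z = pws (fun k => k%:R * c k) z.
Proof.
move=> tc z1; apply/esym/csum_unique; rewrite -cvg_shiftS.
rewrite (_ : (fun n => _) = (fun n => (z : R[i]) *:
    series (fun k => (pws_diff c k)%:C * z ^+ k : R[i]^o) n)); last first.
  apply/funext => n; rewrite /series/= big_nat_recl//= mul0r mul0r add0r.
  rewrite scaler_sumr; apply: eq_bigr => k _.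
  by rewrite /GRing.scale/= mulrCA -exprS.
by apply: cvgZr; apply: cvg_pws => //; exact: tame_diff.
Qed.

(** [pws_diff_binc] says F' = g F + z F' on coefficients. *)
Lemma binomial_ode g z : 0 < g -> normc z < 1 ->
  (1 - z) * pws (pws_diff (binc g)) z = g%:C * pws (binc g) z.
Proof.
move=> g0 z1; have tg := tame_binc g0.
rewrite mulrBl mul1r pws_Xdiff//.
rewrite (_ : pws_diff (binc g) = (fun k => g * binc g k + k%:R * binc g k)); last first.
  by apply/funext => k; rewrite pws_diff_binc.
rewrite pwsD// ?pwsZ ?addrK//; last exact: tame_natr.
apply: (tame_le (C := `|g|) tg) => k; by rewrite normrM.
Qed.

Lemma ReB z w : Re (z - w) = Re z - Re w.
Proof. by case: z; case: w. Qed.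

Lemma ImB z w : Im (z - w) = Im z - Im w.
Proof. by case: z; case: w. Qed.

Lemma Re_realM x z : Re (x%:C * z) = x * Re z.
Proof. by case: z => a b; simpc. Qed.

Lemma Im_realM x z : Im (x%:C * z) = x * Im z.
Proof. by case: z => a b; simpc. Qed.

Lemma sqr_normc z : normc z ^+ 2 = Re z ^+ 2 + Im z ^+ 2.
Proof. by case: z => a b /=; rewrite sqr_sqrtr// addr_ge0// sqr_ge0. Qed.

(* Along the ray t |-> t z, the equation (1 - w) F'(w) = g F(w) makes
   |F(t z)|^2 |1 - t z|^(2 g) constant. *)
Lemma normc_binomial g z : 0 < g -> normc z < 1 ->
  normc (pws (binc g) z) = normc (1 - z) `^ (- g).
Proof.
move=> g0 z1; have tg := tame_binc g0.
pose F := pws (binc g); pose D := pws (pws_diff (binc g)).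
pose x := Re z; pose y := Im z.
pose U t := Re (F (t%:C * z)); pose V t := Im (F (t%:C * z)).
pose P t := Re (z * D (t%:C * z)); pose Q t := Im (z * D (t%:C * z)).
have tz1 t : t \in `[0, 1]%R -> normc (t%:C * z) < 1.
  rewrite in_itv/= => /andP[t0 t1]; apply: le_lt_trans z1.
  by rewrite ComplexField.Normc.normcM normc_real ger0_norm// ler_piMl// normc_ge0.
(* The complex remainder estimate restricted to real increments of [t]. It holds on the closed
   interval, so [U] and [V] are differentiable at 0 and 1 as well. *)
have quad t : t \in `[0, 1]%R -> exists M e : R, [/\ 0 < e, 0 <= M &
    forall s : R, `|s| < e ->
     normc (F ((t + s)%:C * z) - F (t%:C * z) - s%:C * (z * D (t%:C * z))) <= M * `|s| ^+ 2].
  move=> t01; have [M M0 hM] := pws_quadratic tg (tz1 t t01).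
  have e0 : 0 < (1 - normc (t%:C * z)) / 2 by have := tz1 t t01; lra.
  exists M, ((1 - normc (t%:C * z)) / 2); split => // s se.
  have nsz : normc (s%:C * z) <= `|s|.
    by rewrite ComplexField.Normc.normcM normc_real ler_piMr// ltW.
  have := hM (s%:C * z) (le_lt_trans nsz se).
  rewrite -mulrDl -rmorphD mulrA => h; apply: le_trans h _.
  by rewrite ler_wpM2l// lerXn2r// nnegrE// normc_ge0.
have dU t : t \in `[0, 1]%R -> is_derive t 1 U (P t).
  move=> /quad[M [e [e0 M0 hM]]]; apply: (is_derive_quadratic e0 M0) => s se.
  apply: le_trans (hM s se); apply: le_trans (le_Re_normc _).
  by rewrite !ReB Re_realM.
have dV t : t \in `[0, 1]%R -> is_derive t 1 V (Q t).
  move=> /quad[M [e [e0 M0 hM]]]; apply: (is_derive_quadratic e0 M0) => s se.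
  apply: le_trans (hM s se); apply: le_trans (le_Im_normc _).
  by rewrite !ImB Im_realM.
(* Real and imaginary parts of the differential equation multiplied by [z]; [w], [q], [f] stand for
   z, z F'(t z) and F(t z). *)
have alg (w q f : R[i]) t : (1 - t%:C * w) * q = g%:C * (w * f) ->
    ((1 - t * Re w) * Re q + t * Im w * Im q = g * (Re w * Re f - Im w * Im f)) /\
    ((1 - t * Re w) * Im q - t * Im w * Re q = g * (Im w * Re f + Re w * Im f)).
  case: w q f => a b [q1 q2] [f1 f2] /(congr1 (fun u => (Re u, Im u))).
  by rewrite /= => -[e1 e2]; split; lra.
have ode t : t \in `[0, 1]%R ->
    ((1 - t * x) * P t + t * y * Q t = g * (x * U t - y * V t)) /\
    ((1 - t * x) * Q t - t * y * P t = g * (y * U t + x * V t)).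
  move=> /tz1 t1; have := binomial_ode g0 t1.
  rewrite -/F -/D => /(congr1 (fun w => z * w)).
  by rewrite mulrCA [z * (g%:C * _)]mulrCA => /alg.
pose W t := (1 - t * x) ^+ 2 + (t * y) ^+ 2.
have WE t : W t = normc (1 - t%:C * z) ^+ 2.
  by rewrite sqr_normc ReB ImB Re_realM Im_realM /= sub0r sqrrN.
have W0 t : t \in `[0, 1]%R -> 0 < W t.
  move=> /tz1 t1; rewrite WE exprn_gt0//.
  have := le_normc_sub 1 (t%:C * z); rewrite ComplexField.Normc.normc1.
  by apply: lt_le_trans; rewrite normr_gt0 subr_eq0 gt_eqF.
pose W' t := - 2 * x * (1 - t * x) + 2 * t * y ^+ 2.
have dW t : is_derive t 1 W (W' t).
  apply: is_derive_eq; rewrite /W' /GRing.scale/=; ring.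
pose Phi t := (U t ^+ 2 + V t ^+ 2) * W t `^ g.
have dPhi t : t \in `[0, 1]%R -> is_derive t 1 Phi 0.
  move=> t01; have dUt := dU t t01; have dVt := dV t t01; have dWt := dW t.
  have dWg : is_derive t 1 (fun t => W t `^ g) (g * W t `^ (g - 1) * W' t).
    have dp := is_derive1_powR g (W0 t t01).
    exact: (@is_derive1_comp _ (fun u => u `^ g) W).
  apply: is_derive_eq.
  have [eq1 eq2] := ode t t01.
  rewrite -(mulr_powRB1 (ltW (W0 t t01)) g0) /GRing.scale/=.
  (* The derivative of [Phi] is this left-hand side times W^(g-1). As [W] is the determinant of the
     system [ode] in [P] and [Q], the product (U P + V Q) W is a combination of the two left-hand
     sides of [ode]. *)
  have key : 2 * (U t * P t + V t * Q t) * W t + g * (U t ^+ 2 + V t ^+ 2) * W' t = 0.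
    rewrite -[X in X + _]mulrA.
    have -> : (U t * P t + V t * Q t) * W t =
      U t * ((1 - t * x) * ((1 - t * x) * P t + t * y * Q t) - t * y * ((1 - t * x) * Q t - t * y * P t))
      + V t * ((1 - t * x) * ((1 - t * x) * Q t - t * y * P t) + t * y * ((1 - t * x) * P t + t * y * Q t)).
      by rewrite /W; ring.
    rewrite eq1 eq2 /W'; ring.
  by rewrite -[RHS](mulr0 (W t `^ (g - 1))) -key; ring.
have cPhi : {within `[0, 1], continuous Phi}.
  by apply: derivable_within_continuous => t t01; have [] := dPhi t t01.
have dPhi' t : t \in `]0, 1[%R -> is_derive t 1 Phi ((fun=> 0) t).
  by move=> t01; apply: dPhi; exact: subset_itv_oo_cc t01.
have [t _] := MVT ltr01 dPhi' cPhi.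
rewrite mul0r => /subr0_eq.
have F0 : F (0%:C * z) = 1.
  rewrite mul0r; apply: csum_unique; rewrite -cvg_shiftS.
  rewrite (_ : (fun _ => _) = (fun=> 1 : R[i]^o)); last first.
    apply/funext => n; rewrite /series/= big_nat_recl//= binc0 mulr1 big1 ?addr0// => k _.
    by rewrite exprS mul0r mulr0.
  exact: cvg_cst.
rewrite /Phi /U /V F0 !mul1r -!sqr_normc ComplexField.Normc.normc1 expr1n mul1r.
rewrite !WE mul1r mul0r subr0 ComplexField.Normc.normc1 expr1n powR1.
rewrite -/F => h; have nz0 : 0 < normc (1 - z).
  have := W0 1 ltac:(by rewrite in_itv/= ler01 lexx).
  rewrite WE mul1r; have := normc_ge0 (1 - z); rewrite le_eqVlt => /predU1P[<-|//].
  by rewrite expr0n/= ltxx.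
have h2 : (normc (F z) * normc (1 - z) `^ g) ^+ 2 = 1.
  rewrite exprMn -h; congr (_ * _).
  by rewrite -(@powR_mulrn R _ 2 (powR_ge0 _ _)) -(@powR_mulrn R _ 2 (ltW nz0)) powRAC.
have : normc (F z) * normc (1 - z) `^ g = 1.
  apply/eqP; rewrite -(@eqrXn2 _ 2)//; first by rewrite h2 expr1n.
  by rewrite mulr_ge0 ?powR_ge0 ?normc_ge0.
rewrite powRN => /(canRL (mulfK _)); rewrite div1r; apply.
by rewrite gt_eqF// powR_gt0.
Qed.

(** At a real point the terms are nonnegative, so the sum equals its modulus, which [normc_binomial]
    gives. *)
Lemma binomial_real g t : 0 < g -> 0 <= t < 1 ->
  (series (fun k => binc g k * t ^+ k)) @ \oo --> ((1 - t) `^ (- g)).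
Proof.
move=> g0 /andP[t0 t1]; have tg := tame_binc g0.
have [|M hM] := tame_sum (r := t) tg; first by rewrite t0 t1.
have p0 k : 0 <= binc g k * t ^+ k.
  by rewrite mulr_ge0 ?exprn_ge0// ltW// binc_gt0.
have cs : cvgn (series (fun k => binc g k * t ^+ k)).
  apply: (bounded_cvgn_series p0 (M := M)) => n; rewrite (le_trans _ (hM n))//.
  by apply: ler_sum => k _; rewrite gtr0_norm ?binc_gt0.
have l0 : 0 <= limn (series (fun k => binc g k * t ^+ k)).
  by apply: limr_ge => //; near=> n; exact: sumr_ge0.
rewrite (_ : _ `^ _ = limn (series (fun k => binc g k * t ^+ k)))//.
have tt1 : normc (t%:C : R[i]) < 1 by rewrite normc_real ger0_norm.
rewrite -(ger0_norm (ltW (_ : 0 < 1 - t))) ?subr_gt0//.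
rewrite -normc_real rmorphB rmorph1 -normc_binomial// -[RHS]ger0_norm// -normc_real.
congr (normc _); apply: csum_unique.
rewrite (_ : series _ = (fun n => (series (fun k => binc g k * t ^+ k) n)%:C)); last first.
  apply/funext => n; rewrite /series/= rmorph_sum; apply: eq_bigr => k _.
  by rewrite rmorphM rmorphXn.
exact: cvgC_real.
Unshelve. all: by end_near. Qed.

End binomial_series.

(** * Improper integrals *)

Section improper_integrals.
Context {R : realType}.
Local Notation mu := lebesgue_measure.
Implicit Types (F G H : R -> R) (u v : R^nat) (a b : R).

(** The integrals of [G] and [H] may be infinite, so the identity is kept additive. It is the
    fundamental theorem on each compact interval, passed to the limit by monotone convergence for
    [G] and [H] separately. *)
Lemma FTC_exhaustion F G H u v A B (D : set R) :
  (forall n, u n < v n) -> nonincreasing_seq u -> nondecreasing_seq v ->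
  D = \bigcup_n `[u n, v n]%classic ->
  (forall x, D x -> 0 <= G x) -> (forall x, D x -> 0 <= H x) ->
  (forall x, D x -> {for x, continuous G}) ->
  (forall x, D x -> {for x, continuous H}) ->
  (forall x, D x -> is_derive x 1 F (G x - H x)) ->
  F (u n) @[n --> \oo] --> A -> F (v n) @[n --> \oo] --> B ->
  (\int[mu]_(x in D) (G x)%:E + A%:E = \int[mu]_(x in D) (H x)%:E + B%:E)%E.
Proof.
move=> uv niu ndv DE G0 H0 cG cH dF Fu Fv.
have uvD n x : x \in `[u n, v n]%R -> D x by move=> xuv; rewrite DE; exists n.
have cw (K : R -> R) : (forall x, D x -> {for x, continuous K}) -> forall n,
    {within `[u n, v n], continuous K}.
  by move=> cK n; apply: continuous_in_subspaceT => x; rewrite inE => /uvD/cK.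
have step n : (\int[mu]_(x in `[u n, v n]) (G x)%:E + (F (u n))%:E =
    \int[mu]_(x in `[u n, v n]) (H x)%:E + (F (v n))%:E)%E.
  have iG : mu.-integrable `[u n, v n] (EFin \o G).
    by apply: continuous_compact_integrable; [exact: segment_compact|exact: cw].
  have iH : mu.-integrable `[u n, v n] (EFin \o H).
    by apply: continuous_compact_integrable; [exact: segment_compact|exact: cw].
  have : (\int[mu]_(x in `[u n, v n]) (G x - H x)%:E = (F (v n))%:E - (F (u n))%:E)%E.
    apply: (@continuous_FTC2 _ (fun x => G x - H x)) => //.
    - apply: continuous_in_subspaceT => x; rewrite inE => /uvD xD.
      by apply: continuousB; [exact: cG|exact: cH].
    - have cF x : x \in `[u n, v n]%R -> {for x, continuous F}.
        move=> /uvD xD; apply/differentiable_continuous/derivable1_diffP.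
        by have [] := dF x xD.
      split.
      + by move=> x /subset_itv_oo_cc/uvD xD; have [] := dF x xD.
      + by apply: cvg_at_right_filter; apply: cF; rewrite in_itv/= lexx ltW.
      + by apply: cvg_at_left_filter; apply: cF; rewrite in_itv/= lexx ltW.
    - move=> x /subset_itv_oo_cc/uvD xD; rewrite derive1E.
      by have [_ ->] := dF x xD.
  rewrite integralB_EFin//.
  have /fineK <- : (\int[mu]_(x in `[u n, v n]) (G x)%:E)%E \is a fin_num.
    exact: integrable_fin_num iG.
  have /fineK <- : (\int[mu]_(x in `[u n, v n]) (H x)%:E)%E \is a fin_num.
    exact: integrable_fin_num iH.
  rewrite -!EFinB -!EFinD => -[] e.
  by congr EFin; lra.
have lim (K : R -> R) : (forall x, D x -> 0 <= K x) -> (forall x, D x -> {for x, continuous K}) ->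
    (\int[mu]_(x in `[u n, v n]) (K x)%:E @[n --> \oo] --> \int[mu]_(x in D) (K x)%:E)%E.
  move=> K0 cK; rewrite DE; apply: ge0_nondecreasing_set_cvg_integral => //.
  - move=> m n mn; rewrite subsetEset; apply: subset_itvScc => //; rewrite bnd_simp.
      exact: niu.
    exact: ndv.
  - move=> n; apply/measurable_EFinP.
    by apply: subspace_continuous_measurable_fun => //; exact: cw.
  - by move=> n x /uvD/K0; rewrite lee_fin.
have limD (K : R -> R) (w : R^nat) C : (forall x, D x -> 0 <= K x) ->
    (forall x, D x -> {for x, continuous K}) -> w @ \oo --> C ->
    (\int[mu]_(x in `[u n, v n]) (K x)%:E + (w n)%:E @[n --> \oo] -->
     \int[mu]_(x in D) (K x)%:E + C%:E)%E.
  move=> K0 cK wC; apply: cvgeD; [|exact: lim|].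
    by rewrite fin_num_adde_defl.
  by apply: cvg_EFin => //; near=> n.
have := limD _ _ _ G0 cG Fu; under eq_fun do rewrite step.
have := limD _ _ _ H0 cH Fv.
by move=> h1 h2; apply: cvg_unique h2 h1; exact: ereal_hausdorff.
Unshelve. all: by end_near. Qed.

Lemma cvg_divSn (c : R) m : c / (n + m.+1)%:R @[n --> \oo] --> 0.
Proof.
rewrite -(mulr0 c); apply: cvgM; first exact: cvg_cst.
rewrite (_ : (fun n => _) = (fun n => harmonic (n + m)%N)); last first.
  by apply/funext => n; rewrite /harmonic addnS.
by rewrite cvg_shiftn; exact: cvg_harmonic.
Qed.

Lemma FTC_oo F G H a b A B : a < b ->
  (forall x, a < x < b -> 0 <= G x) -> (forall x, a < x < b -> 0 <= H x) ->
  (forall x, a < x < b -> {for x, continuous G}) ->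
  (forall x, a < x < b -> {for x, continuous H}) ->
  (forall x, a < x < b -> is_derive x 1 F (G x - H x)) ->
  F x @[x --> a^'+] --> A -> F x @[x --> b^'-] --> B ->
  (\int[mu]_(x in `]a, b[) (G x)%:E + A%:E = \int[mu]_(x in `]a, b[) (H x)%:E + B%:E)%E.
Proof.
move=> ab G0 H0 cG cH dF FA FB; have ba : 0 < b - a by rewrite subr_gt0.
(* Dividing by n + 3 gives [2 * e n < b - a], so the interval from a + e n to b - e n is proper
   already for n = 0. *)
pose e n : R := (b - a) / (n + 3)%:R.
have e0 n : 0 < e n by rewrite divr_gt0// ltr0n addn_gt0 orbT.
have e2 n : 2 * e n < b - a.
  rewrite /e mulrA ltr_pdivrMr ?ltr0n ?addn_gt0 ?orbT// mulrC ltr_pM2l//.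
  by rewrite ltr_nat; lia.
have ndec n m : (n <= m)%N -> e m <= e n.
  move=> nm; rewrite /e ler_pM2l// lef_pV2 ?posrE ?ltr0n ?addn_gt0 ?orbT//.
  by rewrite ler_nat leq_add2r.
have ecvg : e n @[n --> \oo] --> 0 by exact: cvg_divSn.
apply: (@FTC_exhaustion F G H (fun n => a + e n) (fun n => b - e n)).
- by move=> n; have := e2 n; lra.
- by move=> n m /ndec; rewrite lerD2l.
- by move=> n m /ndec; rewrite lerD2l lerN2.
- apply/seteqP; split=> [x /=|x [n _] /=]; rewrite !in_itv/= => /andP[ax xb].
    have m0 : 0 < Num.min (x - a) (b - x) by rewrite lt_min !subr_gt0 ax.
    have [N _ hN] := cvgr_lt 0 ecvg _ m0.
    exists N => //=; have := hN N (leqnn N); rewrite /= lt_min => /andP[h1 h2].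
    by rewrite in_itv/= -lerBrDl (ltW h1) lerBrDl -lerBrDr (ltW h2).
  by rewrite (lt_le_trans _ ax) ?ltrDl// (le_lt_trans xb)// gtrDl oppr_lt0.
- by move=> x /=; rewrite ?in_itv/=; exact: G0.
- by move=> x /=; rewrite ?in_itv/=; exact: H0.
- by move=> x /=; rewrite ?in_itv/=; exact: cG.
- by move=> x /=; rewrite ?in_itv/=; exact: cH.
- apply: ((cvg_at_rightP _ _ _).1 FA); split; first by move=> n; rewrite ltrDl.
  by rewrite -[X in _ --> X]addr0; apply: cvgD => //; exact: cvg_cst.
- apply: ((cvg_at_leftP _ _ _).1 FB); split; first by move=> n; rewrite gtrDl oppr_lt0.
  by rewrite -[X in _ --> X]subr0; apply: cvgB => //; exact: cvg_cst.
Qed.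

Lemma FTC_0y F G H (A B : R) :
  (forall x : R, 0 < x -> 0 <= G x) -> (forall x : R, 0 < x -> 0 <= H x) ->
  (forall x : R, 0 < x -> {for x, continuous G}) ->
  (forall x : R, 0 < x -> {for x, continuous H}) ->
  (forall x : R, 0 < x -> is_derive x 1 F (G x - H x)) ->
  F x @[x --> 0^'+] --> A -> F x @[x --> +oo%R] --> B ->
  (\int[mu]_(x in `]0%R, +oo[) (G x)%:E + A%:E = \int[mu]_(x in `]0%R, +oo[) (H x)%:E + B%:E)%E.
Proof.
move=> G0 H0 cG cH dF FA FB.
(* With n + 2 the left end stays below the right end n + 1 from n = 0 on. *)
pose e n : R := 1 / (n + 2)%:R.
have e0 n : 0 < e n by rewrite divr_gt0// ltr0n addn_gt0 orbT.
have ndec n m : (n <= m)%N -> e m <= e n.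
  move=> nm; rewrite /e ler_pM2l// lef_pV2 ?posrE ?ltr0n ?addn_gt0 ?orbT//.
  by rewrite ler_nat leq_add2r.
have ecvg : e n @[n --> \oo] --> 0 by exact: cvg_divSn.
apply: (@FTC_exhaustion F G H e (fun n => n.+1%:R)).
- move=> n; rewrite /e ltr_pdivrMr ?ltr0n ?addn_gt0 ?orbT// -natrM ltr1n; nia.
- exact: ndec.
- by move=> n m nm; rewrite ler_nat.
- apply/seteqP; split=> [x /=|x [n _] /=]; rewrite !in_itv/= ?andbT; last first.
    by move=> /andP[ex _]; rewrite (lt_le_trans _ ex).
  move=> x0; have [N _ hN] := cvgr_lt 0 ecvg _ x0.
  pose M := maxn N (Num.truncn x); exists M => //=; rewrite in_itv/=.
  rewrite (ltW (hN M _)) /= ?leq_maxl//; apply: le_trans (ltW (truncnS_gt _)) _.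
  by rewrite ler_nat ltnS leq_maxr.
- by move=> x /=; rewrite ?in_itv/= andbT; exact: G0.
- by move=> x /=; rewrite ?in_itv/= andbT; exact: H0.
- by move=> x /=; rewrite ?in_itv/= andbT; exact: cG.
- by move=> x /=; rewrite ?in_itv/= andbT; exact: cH.
- by move=> x /=; rewrite ?in_itv/= ?andbT; exact: dF.
- by apply: ((cvg_at_rightP _ _ _).1 FA).
- apply: (cvg_comp _ _ _ FB).
  by rewrite (cvg_shiftS (fun n => n%:R : R)); exact: cvgr_idn.
Qed.

Lemma continuous_powR (c x : R) : 0 < x -> {for x, continuous (@powR R ^~ c)}.
Proof.
move=> x0; apply/differentiable_continuous/derivable1_diffP.
by apply: derivable_powR; rewrite in_itv/= x0.
Qed.

Lemma cvg_powR0 a (c : R) : 0 < c -> (x - a) `^ c @[x --> a^'+] --> 0.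
Proof.
move=> c0; apply/cvg_at_rightP => w [wa cw].
apply: ((cvg_at_rightP _ _ _).1 (powR_cvg0 c0) (fun n => w n - a)); split.
  by move=> n; rewrite subr_gt0.
by rewrite -(subrr a); apply: cvgB => //; exact: cvg_cst.
Qed.

Lemma cvg_powR0_left b (c : R) : 0 < c -> (b - x) `^ c @[x --> b^'-] --> 0.
Proof.
move=> c0; apply/cvg_at_leftP => w [wa cw].
apply: ((cvg_at_rightP _ _ _).1 (powR_cvg0 c0) (fun n => b - w n)); split.
  by move=> n; rewrite subr_gt0.
by rewrite -(subrr b); apply: cvgB => //; exact: cvg_cst.
Qed.

Lemma integral_powR_right a b (c : R) : a < b -> -1 < c ->
  (\int[mu]_(x in `]a, b[) ((x - a) `^ c)%:E = ((b - a) `^ (c + 1) / (c + 1))%:E)%E.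
Proof.
move=> ab c1; have c10 : 0 < c + 1 by lra.
have xa0 x : a < x < b -> 0 < x - a by move=> /andP[? _]; rewrite subr_gt0.
have dsub (x : R) : is_derive x 1 (fun x : R => x - a) 1.
  by apply: is_derive_eq; rewrite subr0.
have dp (e x : R) : a < x < b -> is_derive x 1 (fun x : R => (x - a) `^ e) (e * (x - a) `^ (e - 1)).
  move=> /xa0 x0; have d1 := is_derive1_powR e x0.
  have := @is_derive1_comp _ (fun y : R => y `^ e) (fun x : R => x - a) x _ _ d1 (dsub x).
  by rewrite mulr1.
have := @FTC_oo (fun x => (x - a) `^ (c + 1) / (c + 1)) (fun x => (x - a) `^ c) (fun=> 0) a b 0
  ((b - a) `^ (c + 1) / (c + 1)) ab.
rewrite integral0 adde0 add0e; apply.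
- by move=> x _; exact: powR_ge0.
- by [].
- move=> x xab; apply/differentiable_continuous/derivable1_diffP.
  by have [] := dp c x xab.
- by move=> x _; exact: cst_continuous.
- move=> x xab; have := dp (c + 1) x xab; rewrite addrK => h.
  apply: is_derive_eq; rewrite /GRing.scale/=; field; lra.
- rewrite -(mul0r (c + 1)^-1); apply: cvgM; last exact: cvg_cst.
  exact: cvg_powR0.
- apply: cvg_at_left_filter; apply: cvgM; last exact: cvg_cst.
  have b0 : 0 < b - a by rewrite subr_gt0.
  apply: (@continuous_comp _ _ _ (fun x : R => x - a) (fun y : R => y `^ (c + 1))).
    by apply: cvgB => //; exact: cvg_cst.
  exact: continuous_powR.
Qed.

Lemma integral_powR_left a b (c : R) : a < b -> -1 < c ->
  (\int[mu]_(x in `]a, b[) ((b - x) `^ c)%:E = ((b - a) `^ (c + 1) / (c + 1))%:E)%E.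
Proof.
move=> ab c1; have c10 : 0 < c + 1 by lra.
have xb0 x : a < x < b -> 0 < b - x by move=> /andP[_ ?]; rewrite subr_gt0.
have dsub (x : R) : is_derive x 1 (fun x : R => b - x) (-1).
  by apply: is_derive_eq; ring.
have dp (e x : R) : a < x < b -> is_derive x 1 (fun x : R => (b - x) `^ e) (- (e * (b - x) `^ (e - 1))).
  move=> /xb0 x0; have d1 := is_derive1_powR e x0.
  have := @is_derive1_comp _ (fun y : R => y `^ e) (fun x : R => b - x) x _ _ d1 (dsub x).
  by rewrite mulrN1.
have := @FTC_oo (fun x => (b - a) `^ (c + 1) / (c + 1) - (b - x) `^ (c + 1) / (c + 1))
  (fun x => (b - x) `^ c) (fun=> 0) a b 0
  ((b - a) `^ (c + 1) / (c + 1)) ab.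
rewrite integral0 adde0 add0e; apply.
- by move=> x _; exact: powR_ge0.
- by [].
- move=> x xab; apply/differentiable_continuous/derivable1_diffP.
  by have [] := dp c x xab.
- by move=> x _; exact: cst_continuous.
- move=> x xab; have := dp (c + 1) x xab; rewrite addrK => h.
  apply: is_derive_eq; rewrite /GRing.scale/=; field; lra.
- rewrite -[X in _ --> X](subrr ((b - a) `^ (c + 1) / (c + 1))).
  apply: cvgB; first exact: cvg_cst.
  apply: cvg_at_right_filter; apply: cvgM; last exact: cvg_cst.
  have b0 : 0 < b - a by rewrite subr_gt0.
  apply: (@continuous_comp _ _ _ (fun x : R => b - x) (fun y : R => y `^ (c + 1))).
    by apply: cvgB => //; exact: cvg_cst.
  exact: continuous_powR.
- rewrite -[X in _ --> X]subr0; apply: cvgB; first exact: cvg_cst.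
  rewrite -(mul0r (c + 1)^-1); apply: cvgM; last exact: cvg_cst.
  exact: cvg_powR0_left.
Qed.

End improper_integrals.

(** * The Beta function *)

Section beta.
Context {R : realType}.
Local Notation mu := (@lebesgue_measure R).
Implicit Types (s t x y : R).

Definition beta_kernel s t x := x `^ (s - 1) * (1 - x) `^ (t - 1).

Lemma beta_kernel_ge0 s t x : 0 <= beta_kernel s t x.
Proof. by rewrite mulr_ge0 ?powR_ge0. Qed.

Lemma measurable_beta_kernel s t (D : set R) : measurable_fun D (beta_kernel s t).
Proof.
apply: measurable_funTS; apply: measurable_funM; first exact: measurable_powR.
apply: (measurableT_comp (measurable_powR _)).
by apply: measurable_funB => //; exact: measurable_cst.
Qed.

Lemma integrableRD (i : interval R) (f g : R -> R) :
  mu.-integrable [set` i] (EFin \o f) -> mu.-integrable [set` i] (EFin \o g) ->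
  mu.-integrable [set` i] (EFin \o (fun x => f x + g x)).
Proof.
move=> fi gi; have h : mu.-integrable [set` i] ((EFin \o f) \+ (EFin \o g))%E.
  by apply: integrableD.
exact: h.
Qed.

Lemma integrableRZ (i : interval R) (c : R) (f : R -> R) :
  mu.-integrable [set` i] (EFin \o f) -> mu.-integrable [set` i] (EFin \o (fun x => c * f x)).
Proof.
move=> fi; have h : mu.-integrable [set` i] (fun x => c%:E * (EFin \o f) x)%E.
  by apply: integrableZl.
exact: h.
Qed.

(** On each half of the interval the factor that is not singular there is at most 2, because y^(e-1)
    <= 1 / y <= 2 for 1/2 <= y < 1. Both one-sided powers are integrable. *)
Lemma beta_integrable s t : 0 < s -> 0 < t ->
  mu.-integrable `]0, 1[ (EFin \o beta_kernel s t).
Proof.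
move=> s0 t0; pose g x := 2 * ((x - 0) `^ (s - 1) + (1 - x) `^ (t - 1)).
have ir : mu.-integrable `]0, 1[ (EFin \o (fun x => (x - 0) `^ (s - 1))).
  apply/integrableP; split.
    apply/measurable_EFinP/measurable_funTS.
    apply: (measurableT_comp (measurable_powR _)).
    by apply: measurable_funB => //; exact: measurable_cst.
  under eq_integral do rewrite /= ger0_norm ?powR_ge0//.
  by rewrite integral_powR_right ?ltry//; lra.
have il : mu.-integrable `]0, 1[ (EFin \o (fun x => (1 - x) `^ (t - 1))).
  apply/integrableP; split.
    apply/measurable_EFinP/measurable_funTS.
    apply: (measurableT_comp (measurable_powR _)).
    by apply: measurable_funB => //; exact: measurable_cst.
  under eq_integral do rewrite /= ger0_norm ?powR_ge0//.
  by rewrite integral_powR_left ?ltry//; lra.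
have ig : mu.-integrable `]0, 1[ (EFin \o g).
  exact: integrableRZ (integrableRD ir il).
apply: le_integrable ig => //.
  by apply/measurable_EFinP; exact: measurable_beta_kernel.
move=> x /=; rewrite in_itv/= => /andP[x0 x1].
rewrite lee_fin ger0_norm ?beta_kernel_ge0// ger0_norm; last first.
  by rewrite mulr_ge0 ?addr_ge0 ?powR_ge0.
rewrite /g /beta_kernel subr0.
have half y e : 2^-1 <= y -> y < 1 -> 0 < e -> y `^ (e - 1) <= 2.
  move=> y2 y1 e0; have y0 : 0 < y by lra.
  rewrite (@le_trans _ _ (y `^ (-1)))//.
    by rewrite ger_powR ?y0 ?ltW//; lra.
  by rewrite powR_inv1 ?(ltW y0)// -[leRHS]invrK lef_pV2 ?posrE.
have [x2|x2] := leP x 2^-1.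
  rewrite mulrDr mulrC ler_wpDr ?mulr_ge0 ?powR_ge0// ler_wpM2r ?powR_ge0//.
  by apply: half => //; lra.
rewrite mulrDr ler_wpDl ?mulr_ge0 ?powR_ge0// ler_wpM2r ?powR_ge0//.
by apply: half => //; lra.
Qed.

Lemma EFin_Beta s t : 0 < s -> 0 < t ->
  ((Beta s t)%:E = \int[mu]_(x in `]0%R, 1%R[) (beta_kernel s t x)%:E)%E.
Proof.
by move=> s0 t0; rewrite /Beta /Rintegral fineK//; apply: integrable_fin_num => //; exact: beta_integrable.
Qed.

Lemma Beta_le2 (s1 t1 s2 t2 s3 t3 s4 t4 a1 a2 a3 a4 : R) :
  0 < s1 -> 0 < t1 -> 0 < s2 -> 0 < t2 -> 0 < s3 -> 0 < t3 -> 0 < s4 -> 0 < t4 ->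
  (forall x, 0 < x < 1 -> a1 * beta_kernel s1 t1 x + a2 * beta_kernel s2 t2 x <=
     a3 * beta_kernel s3 t3 x + a4 * beta_kernel s4 t4 x) ->
  a1 * Beta s1 t1 + a2 * Beta s2 t2 <= a3 * Beta s3 t3 + a4 * Beta s4 t4.
Proof.
move=> s10 t10 s20 t20 s30 t30 s40 t40 h.
have iZ (a s t : R) : 0 < s -> 0 < t ->
    mu.-integrable `]0, 1[ (EFin \o (fun x => a * beta_kernel s t x)).
  by move=> s0 t0; exact: integrableRZ (beta_integrable s0 t0).
have lin (a s t a' s' t' : R) : 0 < s -> 0 < t -> 0 < s' -> 0 < t' ->
    a * Beta s t + a' * Beta s' t' =
    \int[mu]_(x in `]0, 1[) (a * beta_kernel s t x + a' * beta_kernel s' t' x).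
  move=> s0 t0 s'0 t'0; rewrite RintegralD; [|by []|exact: iZ|exact: iZ].
  rewrite RintegralZl; [|by []|exact: beta_integrable].
  by rewrite RintegralZl; [|by []|exact: beta_integrable].
rewrite lin; [|by []..]; rewrite lin; [|by []..].
apply: le_Rintegral; [by []|apply: integrableRD; exact: iZ|apply: integrableRD; exact: iZ|].
by move=> x /=; rewrite in_itv; exact: h.
Qed.

(* Unfolding [Beta] makes unification of terms in several Beta values very slow. *)
Local Opaque Beta.

Lemma Beta_le (s t s' t' c : R) : 0 < s -> 0 < t -> 0 < s' -> 0 < t' ->
  (forall x, 0 < x < 1 -> beta_kernel s t x <= c * beta_kernel s' t' x) ->
  Beta s t <= c * Beta s' t'.
Proof.
move=> s0 t0 s'0 t'0 h.
have le1 (x y : R) : 1 * x + 0 * x <= c * y + 0 * x -> x <= c * y by lra.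
by apply: le1; apply: Beta_le2; try assumption; move=> x /h; lra.
Qed.

Lemma beta_kernelD1l s t x : 0 < x -> beta_kernel (s + 1) t x = x * beta_kernel s t x.
Proof.
move=> x0; rewrite /beta_kernel mulrA; congr (_ * _).
have -> : s + 1 - 1 = 1 + (s - 1) by ring.
by rewrite (@powRD _ _ 1 (s - 1)) ?(gt_eqF x0) ?implybT// powRr1 // ltW.
Qed.

Lemma beta_kernelD1r s t x : x < 1 -> beta_kernel s (t + 1) x = (1 - x) * beta_kernel s t x.
Proof.
move=> x1; rewrite /beta_kernel mulrCA; congr (_ * _).
have x0 : 0 < 1 - x by lra.
have -> : t + 1 - 1 = 1 + (t - 1) by ring.
by rewrite (@powRD _ _ 1 (t - 1)) ?(gt_eqF x0) ?implybT// powRr1 // ltW.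
Qed.

Lemma Beta_split s t : 0 < s -> 0 < t -> Beta s t = Beta (s + 1) t + Beta s (t + 1).
Proof.
move=> s0 t0; have s1 : 0 < s + 1 by lra. have t1 : 0 < t + 1 by lra.
have le1 (x y z : R) : 1 * x + 0 * x <= 1 * y + 1 * z -> x <= y + z by lra.
have le2 (x y z : R) : 1 * y + 1 * z <= 1 * x + 0 * x -> y + z <= x by lra.
apply: le_anti; apply/andP; split.
  apply: le1; apply: Beta_le2; try assumption.
  by move=> x /andP[x0 x1]; rewrite beta_kernelD1l// beta_kernelD1r//; lra.
apply: le2; apply: Beta_le2; try assumption.
by move=> x /andP[x0 x1]; rewrite beta_kernelD1l// beta_kernelD1r//; lra.
Qed.

End beta.

Local Opaque Beta.

(** * Recursion, monotonicity and positivity of Beta *)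

Section beta_recursion.
Context {R : realType}.
Local Notation mu := (@lebesgue_measure R).
Implicit Types (s t x y : R).

(** Integration by parts: x^s (1 - x)^t vanishes at both ends, and its derivative is the difference
    of the two integrands. *)
Lemma Beta_parts s t : 0 < s -> 0 < t -> s * Beta s (t + 1) = t * Beta (s + 1) t.
Proof.
move=> s0 t0; have s1 : 0 < s + 1 by lra. have t1 : 0 < t + 1 by lra.
have dsub (x : R) : is_derive x 1 (fun x : R => 1 - x) (-1).
  by apply: is_derive_eq; ring.
have dr (e x : R) : 0 < x < 1 -> is_derive x 1 (fun x : R => (1 - x) `^ e) (- (e * (1 - x) `^ (e - 1))).
  move=> /andP[x0 x1]; have x10 : 0 < 1 - x by lra.
  have d1 := is_derive1_powR e x10.
  have := @is_derive1_comp _ (fun y : R => y `^ e) (fun x : R => 1 - x) x _ _ d1 (dsub x).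
  by rewrite mulrN1.
have ck (u v : R) x : 0 < x < 1 -> {for x, continuous (beta_kernel u v)}.
  move=> x01; have /andP[x0 x1] := x01; apply: cvgM; first exact: continuous_powR.
  have h : {for x, continuous (fun x : R => (1 - x) `^ (v - 1))}.
    apply/differentiable_continuous/derivable1_diffP.
    by have [] := dr (v - 1) x x01.
  exact: h.
have := @FTC_oo R (fun x => x `^ s * (1 - x) `^ t) (fun x => s * beta_kernel s (t + 1) x)
  (fun x => t * beta_kernel (s + 1) t x) 0 1 0 0 ltr01.
rewrite !adde0 => h.
have scale (c u v : R) : 0 < c -> 0 < u -> 0 < v ->
    ((c * Beta u v)%:E = \int[mu]_(x in `]0%R, 1%R[) (c * beta_kernel u v x)%:E)%E.
  move=> c0 u0 v0; rewrite EFinM EFin_Beta// -ge0_integralZl_EFin; [by []|by []| | |exact: ltW].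
    by move=> x _; rewrite lee_fin beta_kernel_ge0.
  by apply/measurable_EFinP; exact: measurable_beta_kernel.
apply: EFin_inj; rewrite scale; [|by []..]; rewrite scale; [|by []..]; apply: h.
- by move=> x _; rewrite mulr_ge0 ?beta_kernel_ge0 ?ltW.
- by move=> x _; rewrite mulr_ge0 ?beta_kernel_ge0 ?ltW.
- by move=> x x01; apply: cvgM; [exact: cvg_cst|exact: ck].
- by move=> x x01; apply: cvgM; [exact: cvg_cst|exact: ck].
- move=> x x01; have /andP[x0 x1] := x01.
  have d1 := is_derive1_powR s x0; have d2 := dr t x x01.
  apply: is_derive_eq; rewrite /GRing.scale/= /beta_kernel !addrK; ring.
- rewrite -[X in _ --> X](mul0r ((1 - 0 : R) `^ t)); apply: cvgM.
    exact: powR_cvg0.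
  apply: cvg_at_right_filter.
  apply: (@continuous_comp _ _ _ (fun x : R => 1 - x) (fun y : R => y `^ t)).
    by apply: cvgB => //; exact: cvg_cst.
  by apply: continuous_powR; rewrite subr0.
- rewrite -[X in _ --> X](mulr0 (1 `^ s)); apply: cvgM; last exact: cvg_powR0_left.
  by apply: cvg_at_left_filter; exact: continuous_powR.
Qed.

(** [Beta_split] and [Beta_parts] are two linear equations for Beta (s + 1) t and Beta s (t + 1). *)
Lemma BetaD1l s t : 0 < s -> 0 < t -> Beta (s + 1) t = s / (s + t) * Beta s t.
Proof.
move=> s0 t0; have st0 : s + t != 0 by rewrite gt_eqF//; lra.
have alg (x y z : R) : x = y + z -> s * z = t * y -> y = s / (s + t) * x.
  move=> -> e; apply: (mulfI st0); rewrite mulrA mulrCA divff// mulr1 mulrDr e; ring.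
exact: alg (Beta_split s0 t0) (Beta_parts s0 t0).
Qed.

Lemma BetaD1r s t : 0 < s -> 0 < t -> Beta s (t + 1) = t / (s + t) * Beta s t.
Proof.
move=> s0 t0; have st0 : s + t != 0 by rewrite gt_eqF//; lra.
have alg (x y z : R) : x = y + z -> s * z = t * y -> z = t / (s + t) * x.
  move=> -> e; apply: (mulfI st0); rewrite mulrA mulrCA divff// mulr1 mulrDr -e; ring.
exact: alg (Beta_split s0 t0) (Beta_parts s0 t0).
Qed.

Lemma Beta1 t : 0 < t -> Beta 1 t = t^-1.
Proof.
move=> t0; apply: EFin_inj; rewrite EFin_Beta//.
have := @integral_powR_left R 0 1 (t - 1) ltr01; rewrite subr0 subrK powR1 div1r => <-; last by lra.
apply: eq_integral => x; rewrite inE/= in_itv/= => /andP[x0 x1].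
by rewrite /beta_kernel subrr powRr0 mul1r.
Qed.

(** Iterating [BetaD1l] from [Beta1] gives m! / (t (t + 1) ... (t + m)). Only such values have to be
    compared with Gamma quotients later. *)
Lemma Beta_nat (m : nat) t : 0 < t -> Beta m.+1%:R t = ((m%:R + t) * binc t m)^-1.
Proof.
move=> t0; elim: m => [|m ih]; first by rewrite Beta1// binc0 add0r mulr1.
rewrite -[m.+2%:R]natr1 BetaD1l ?ltr0n// ih bincS -!natr1.
have := binc_gt0 m t0; move: (binc t m) => c c0; have := ler0n R m; move: (m%:R) => y y0.
field; repeat (apply/andP; split); rewrite gt_eqF//; lra.
Qed.

Lemma Beta_anti s s' t : 0 < s -> 0 < t -> s <= s' -> Beta s' t <= Beta s t.
Proof.
move=> s0 t0 ss; rewrite -[leRHS]mul1r; apply: Beta_le => //; first by lra.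
move=> x /andP[x0 x1]; rewrite mul1r; apply: ler_wpM2r; first exact: powR_ge0.
by apply: ger_powR; [apply/andP; split; lra|lra].
Qed.

(** Monotonicity reduces to an integer first argument, where the value is explicit. *)
Lemma Beta_gt0 s t : 0 < s -> 0 < t -> 0 < Beta s t.
Proof.
move=> s0 t0; have sm : s <= (Num.truncn s).+1%:R by apply: ltW; exact: truncnS_gt.
apply: lt_le_trans (Beta_anti s0 t0 sm).
by rewrite Beta_nat// invr_gt0 mulr_gt0 ?binc_gt0// ltr_wpDl.
Qed.

(** Replacing [d] by the larger integer [m] only lowers the power, and for [m] this is Bernoulli's
    inequality. *)
Lemma onem_powR_le (m : nat) x (d : R) : 0 < x < 1 -> d <= m%:R ->
  1 - x `^ d <= m%:R * (1 - x).
Proof.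
move=> /andP[x0 x1] dm.
have : x `^ (m%:R) <= x `^ d by rewrite ger_powR// x0 ltW.
rewrite powR_mulrn ?(ltW x0)// => h; have : 1 - x ^+ m <= m%:R * (1 - x).
  elim: m {dm h} => [|m ih]; first by rewrite expr0 mul0r subrr.
  have xm : x ^+ m <= 1 by rewrite exprn_ile1// ltW.
  have xm0 : 0 <= x ^+ m by rewrite exprn_ge0// ltW.
  by rewrite exprS -natr1; nra.
by lra.
Qed.

(** [onem_powR_le] is integrated against the kernel. The factor 1 - x raises [t] by one, and the
    resulting t / (s + t) is the source of the decay 1 / n. *)
Lemma Beta_sub_le (m : nat) s t (d : R) : 0 < s -> 0 < t -> 0 <= d -> d <= m%:R ->
  Beta s t - Beta (s + d) t <= m%:R * (t / (s + t)) * Beta s t.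
Proof.
move=> s0 t0 d0 dm; rewrite -mulrA -BetaD1r//.
have le1 (x y z : R) : 1 * x + 0 * x <= 1 * y + m%:R * z -> x - y <= m%:R * z by lra.
have sd0 : 0 < s + d by lra. have t10 : 0 < t + 1 by lra.
apply: le1; apply: Beta_le2; try assumption; move=> x /andP[x0 x1].
rewrite beta_kernelD1r//.
have -> : beta_kernel (s + d) t x = x `^ d * beta_kernel s t x.
  rewrite /beta_kernel mulrA; congr (_ * _).
  have -> : s + d - 1 = d + (s - 1) by ring.
  by rewrite (@powRD _ _ d (s - 1)) ?(gt_eqF x0) ?implybT.
have := @onem_powR_le m x d; rewrite x0 x1 => /(_ isT dm).
have := beta_kernel_ge0 s t x; move: (beta_kernel s t x) => k k0.
move=> /(ler_wpM2r k0); lra.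
Qed.

End beta_recursion.

(** * Ratios of Beta values and dependence on the parameters *)

Section beta_asymptotics.
Context {R : realType}.
Local Notation mu := (@lebesgue_measure R).
Implicit Types (s t x y : R).

(** A unit step in [s] costs the factor (s + t) / s, at most 1 + t once s >= 1. *)
Lemma Beta_shift_le (k : nat) s t : 1 <= s -> 0 < t ->
  Beta s t <= (1 + t) ^+ k * Beta (s + k%:R) t.
Proof.
move=> s1 t0; elim: k => [|k ih]; first by rewrite expr0 mul1r addr0.
apply: le_trans ih _; rewrite exprS (mulrC (1 + t)) -mulrA; apply: ler_wpM2l.
  by rewrite exprn_ge0//; lra.
rewrite -natr1 addrA; have := ler0n R k; set q := k%:R => q0.
have sq0 : 0 < s + q by lra.
rewrite BetaD1l// mulrA; apply: ler_peMl; first exact/ltW/Beta_gt0.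
by rewrite mulrA ler_pdivlMr ?mul1r; nra.
Qed.

(** Arithmetic of the case g >= 1 of [Beta_ratio]: [x] and [y] are the numerator and the denominator
    there and [N] is n + 1. The difference is controlled relative to [x], and [T] converts this to
    [y]. *)
Lemma ratio_le_large (x y N M T g t : R) : 0 < y -> y <= x ->
  x - y <= M * (t / (N + t)) * x -> x <= T * y ->
  1 <= N -> 1 <= T -> 0 <= M -> 0 < t -> 0 < g ->
  `|x / y - 1| <= M * (g + t) * T * (1 + t) / N.
Proof.
move=> y0 yx h xT N1 T1 M0 t0 g0.
have -> : x / y - 1 = (x - y) / y by rewrite mulrBl divff// gt_eqF.
rewrite ger0_norm ?divr_ge0 ?subr_ge0 ?(ltW y0)// ler_pdivrMr//.
apply: le_trans h _.
apply: (@le_trans _ _ (M * (t / (N + t)) * (T * y))).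
  by apply: ler_wpM2l => //; apply: mulr_ge0 => //; apply: divr_ge0; lra.
have h3 : t / (N + t) <= (g + t) * (1 + t) / N.
  have N0 : 0 < N by lra. have Nt0 : 0 < N + t by lra.
  have a : t <= (g + t) * (1 + t) by nra.
  rewrite ler_pdivlMr// mulrAC ler_pdivrMr//.
  by move: (_ * (1 + t)) a => X a; nra.
rewrite [leLHS](_ : _ = (M * T * y) * (t / (N + t))); last by ring.
rewrite [leRHS](_ : _ = (M * T * y) * ((g + t) * (1 + t) / N)); last by ring.
by apply: ler_wpM2l => //; repeat apply: mulr_ge0 => //; lra.
Qed.

(** The case g < 1, where the difference is already relative to [y]; [1 <= g + t] keeps the
    denominator above [N]. *)
Lemma ratio_le_small (x y N M T g t : R) : 0 < y -> x <= y ->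
  y - x <= M * (t / (N - 1 + g + t)) * y ->
  1 <= N -> 1 <= T -> 0 <= M -> 0 < t -> 0 < g -> 1 <= g + t ->
  `|x / y - 1| <= M * (g + t) * T * (1 + t) / N.
Proof.
move=> y0 xy h N1 T1 M0 t0 g0 gt1.
have -> : x / y - 1 = - ((y - x) / y) by rewrite mulrBl divff ?gt_eqF//; ring.
rewrite normrN ger0_norm ?divr_ge0 ?subr_ge0 ?(ltW y0)// ler_pdivrMr//.
apply: le_trans h _; apply: ler_wpM2r; first exact: ltW.
rewrite -!mulrA; apply: ler_wpM2l => //.
have gt : t <= (g + t) * T.
  have : 0 <= (g + t) * (T - 1) by apply: mulr_ge0; lra.
  lra.
rewrite ler_pdivrMr; last by lra.
rewrite !mulrA mulrAC ler_pdivlMr; last by lra.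
have G0 : 0 <= (g + t) * T by lra.
apply: (@le_trans _ _ ((g + t) * T * N)); first by apply: ler_wpM2r; [lra|exact: gt].
rewrite -[leRHS]mulrA; apply: ler_wpM2l => //; nra.
Qed.

(** The first arguments differ by |g - 1| <= m + 1, so [Beta_sub_le] applies from the smaller one.
    When g + t is fixed and [m] bounds [g], the constant can be bounded independently of [g]. *)
Lemma Beta_ratio (m n : nat) (g t : R) : 0 < g -> 0 < t -> g <= m.+1%:R -> 1 <= g + t ->
  `|Beta n.+1%:R t / Beta (n%:R + g) t - 1| <=
  m.+1%:R * (g + t) * (1 + t) ^+ m.+1 * (1 + t) / n.+1%:R.
Proof.
move=> g0 t0 gm gt1.
have n10 : 0 < n.+1%:R :> R by rewrite ltr0n.
have n1g : 1 <= n.+1%:R :> R by rewrite ler1n.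
have m0 : 0 <= m.+1%:R :> R by rewrite ler0n.
have nE : n%:R = n.+1%:R - 1 :> R by rewrite -natr1; ring.
have ng0 : 0 < n%:R + g by rewrite nE; lra.
have T1 : 1 <= (1 + t) ^+ m.+1 by rewrite exprn_ege1//; lra.
have T0 : 0 <= (1 + t) ^+ m.+1 by lra.
have [g1|g1] := leP 1 g.
  have d0 : 0 <= g - 1 by lra.
  have dm : g - 1 <= m.+1%:R by lra.
  have e : n.+1%:R + (g - 1) = n%:R + g by rewrite nE; ring.
  have le1 : n.+1%:R <= n%:R + g by rewrite nE; lra.
  have le2 : n%:R + g <= n.+1%:R + m.+1%:R by rewrite nE; lra.
  have := Beta_sub_le n10 t0 d0 dm; rewrite e => h.
  apply: ratio_le_large (Beta_gt0 ng0 t0) (Beta_anti n10 t0 le1) h _ _ _ _ _ _; try assumption.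
  apply: le_trans (Beta_shift_le m.+1 n1g t0) _.
  by apply: ler_wpM2l => //; apply: Beta_anti.
have d0 : 0 <= 1 - g by lra.
have dm : 1 - g <= m.+1%:R by have : 1 <= m.+1%:R :> R; [rewrite ler1n|lra].
have e : n%:R + g + (1 - g) = n.+1%:R by rewrite nE; ring.
have le1 : n%:R + g <= n.+1%:R by rewrite nE; lra.
have h : Beta (n%:R + g) t - Beta n.+1%:R t <=
    m.+1%:R * (t / (n.+1%:R - 1 + g + t)) * Beta (n%:R + g) t.
  by rewrite -nE; move: (Beta_sub_le ng0 t0 d0 dm); rewrite e; apply.
by apply: ratio_le_small (Beta_gt0 ng0 t0) (Beta_anti ng0 t0 le1) h _ _ _ _ _ _.
Qed.

(** A quantitative substitute for continuity when [g] approaches its limit, with a loss linear in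
    [h]. The power of x only grows, and (1 - x)^h loses at most -h ln(1 - x), which (1 - x)^(-e)
    dominates; [e < t] keeps that power integrable against the kernel. *)
Lemma Beta_lower s t h e : 0 < s -> 0 < e < t -> 0 <= h < s ->
  Beta s t - h / e * Beta s (t - e) <= Beta (s - h) (t + h).
Proof.
move=> s0 /andP[e0 et] /andP[h0 hs].
have t0 : 0 < t by lra. have te0 : 0 < t - e by lra.
have sh0 : 0 < s - h by lra. have th0 : 0 < t + h by lra.
have le1 (x y z : R) : 1 * x + 0 * x <= 1 * z + h / e * y -> x - h / e * y <= z by lra.
apply: le1; apply: Beta_le2; try assumption; move=> x /andP[x0 x1].
rewrite mul0r addr0 !mul1r.
have y0 : 0 < 1 - x by lra.
have k0 : 0 < x `^ (s - 1) by rewrite powR_gt0.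
have j0 : 0 < (1 - x) `^ (t - 1) by rewrite powR_gt0.
have le3 : x `^ (s - 1) <= x `^ (s - h - 1).
  by apply: ger_powR; [apply/andP; split; lra|lra].
have e1 : (1 - x) `^ (t + h - 1) = (1 - x) `^ h * (1 - x) `^ (t - 1).
  have -> : t + h - 1 = h + (t - 1) by ring.
  by rewrite (@powRD _ _ h (t - 1)) ?(gt_eqF y0) ?implybT.
have e2 : (1 - x) `^ (t - e - 1) = (1 - x) `^ (- e) * (1 - x) `^ (t - 1).
  have -> : t - e - 1 = - e + (t - 1) by ring.
  by rewrite (@powRD _ _ (- e) (t - 1)) ?(gt_eqF y0) ?implybT.
have l1 : 1 + h * ln (1 - x) <= (1 - x) `^ h.
  by rewrite /powR gt_eqF//; exact: expR_ge1Dx.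
have l2 : - (e * ln (1 - x)) <= (1 - x) `^ (- e).
  rewrite /powR gt_eqF// mulNr; apply: le_trans (expR_ge1Dx _); lra.
rewrite /beta_kernel e1 e2.
(* The logarithms of [l1] and [l2] cancel once [l2] is scaled by [h / e]. *)
have key : 1 <= (1 - x) `^ h + h / e * (1 - x) `^ (- e).
  have : h / e * (- (e * ln (1 - x))) <= h / e * (1 - x) `^ (- e).
    by apply: ler_wpM2l => //; rewrite divr_ge0// ltW.
  have -> : h / e * (- (e * ln (1 - x))) = - (h * ln (1 - x)) by field; lra.
  lra.
have p0 := powR_ge0 (1 - x) h.
move: ((1 - x) `^ h) ((1 - x) `^ (- e)) key p0 {l1 l2 e1 e2} => p q key p0.
move: (x `^ _) (x `^ _) ((1 - x) `^ (t - 1)) k0 j0 le3 => k k' j k0 j0 le3.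
have -> : h / e * (k' * (q * j)) = k' * j * (h / e * q) by ring.
have : k' * (p * j) <= k * (p * j) by apply: ler_wpM2r => //; rewrite mulr_ge0// ltW.
have : 0 <= k' * j * (p + h / e * q - 1).
  by apply: mulr_ge0; [apply: mulr_ge0; exact: ltW|lra].
lra.
Qed.

End beta_asymptotics.

(** * Gauss's summation and the weights of the Hilbert operator *)

Section gauss_sum.
Context {R : realType}.
Local Notation mu := (@lebesgue_measure R).
Implicit Types (s t x y : R).

Lemma beta_kernel_shift s t k x : 0 < x ->
  beta_kernel (s + k%:R) t x = x ^+ k * beta_kernel s t x.
Proof.
move=> x0; rewrite /beta_kernel mulrA; congr (_ * _).
have -> : s + k%:R - 1 = k%:R + (s - 1) by ring.
by rewrite (@powRD _ _ k%:R (s - 1)) ?(gt_eqF x0) ?implybT// powR_mulrn ?ltW.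
Qed.

(** The binomial series of (1 - x)^(-g) is integrated termwise against the kernel; all terms are
    nonnegative, so monotone convergence applies. In hypergeometric terms this is the value at 1 of
    2F1(g, s; s + t; .), multiplied by Beta s t. *)
Lemma gauss_sum (g s t : R) : 0 < g < t -> 0 < s ->
  (series (fun k => binc g k * Beta (s + k%:R) t)) @ \oo --> Beta s (t - g).
Proof.
move=> /andP[g0 gt] s0; have t0 : 0 < t by lra. have tg0 : 0 < t - g by lra.
have sk0 k : 0 < s + k%:R by rewrite ltr_wpDr.
pose h n x : \bar R := (\sum_(0 <= k < n) binc g k * beta_kernel (s + k%:R) t x)%:E.
have hint n : (\int[mu]_(x in `]0%R, 1%R[) h n x =
    (series (fun k => binc g k * Beta (s + k%:R) t) n)%:E)%E.
  rewrite /h /series/=.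
  under eq_integral do rewrite -sumEFin.
  rewrite ge0_integral_sum//=; last 2 first.
  - move=> k; apply/measurable_EFinP; apply: measurable_funM => //.
    exact: measurable_beta_kernel.
  - by move=> k x _; rewrite lee_fin mulr_ge0 ?beta_kernel_ge0// ltW// binc_gt0.
  rewrite -sumEFin; apply: eq_bigr => k _.
  rewrite EFinM EFin_Beta// -ge0_integralZl_EFin//.
  - by move=> x _; rewrite lee_fin beta_kernel_ge0.
  - by apply/measurable_EFinP; exact: measurable_beta_kernel.
  - by rewrite ltW// binc_gt0.
have hlim : (\int[mu]_(x in `]0%R, 1%R[) h n x @[n --> \oo] -->
    \int[mu]_(x in `]0%R, 1%R[) limn (h ^~ x))%E.
  apply: cvg_monotone_convergence => //.
  - move=> n; apply/measurable_EFinP; apply: measurable_sum => k.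
    by apply: measurable_funM => //; exact: measurable_beta_kernel.
  - move=> n x _; rewrite lee_fin; apply: sumr_ge0 => k _.
    by rewrite mulr_ge0 ?beta_kernel_ge0// ltW// binc_gt0.
  - move=> x _; apply/nondecreasing_seqP => n; rewrite /h lee_fin big_nat_recr//= lerDl.
    by rewrite mulr_ge0 ?beta_kernel_ge0// ltW// binc_gt0.
suff H : (series (fun k => binc g k * Beta (s + k%:R) t) n)%:E @[n --> \oo] -->
    (Beta s (t - g))%:E by exact: (fine_cvg H).
under eq_fun do rewrite -hint.
rewrite EFin_Beta// (_ : (\int[mu]_(x in _) (beta_kernel s (t - g) x)%:E)%E =
  (\int[mu]_(x in `]0%R, 1%R[) limn (h ^~ x))%E)//.
apply: eq_integral => x; rewrite inE/= in_itv/= => /andP[x0 x1].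
apply/esym/cvg_lim => //; apply: cvg_EFin; first by near=> n.
have := binomial_real g0 (_ : 0 <= x < 1); rewrite (ltW x0) x1 => /(_ isT) hb.
have -> : fine \o h ^~ x = (fun n => series (fun k => binc g k * x ^+ k) n * beta_kernel s t x).
  apply/funext => n; rewrite /h /series/= mulr_suml; apply: eq_bigr => k _.
  by rewrite beta_kernel_shift// mulrA.
have -> : beta_kernel s (t - g) x = (1 - x) `^ (- g) * beta_kernel s t x.
  rewrite /beta_kernel mulrCA; congr (_ * _).
  have y0 : 0 < 1 - x by lra.
  have -> : t - g - 1 = - g + (t - 1) by ring.
  by rewrite (@powRD _ _ (- g) (t - 1)) ?(gt_eqF y0) ?implybT.
by apply: cvgM => //; exact: cvg_cst.
Unshelve. all: by end_near. Qed.

End gauss_sum.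

(** * The Gamma function, and the weights in Beta form *)

Section gamma.
Context {R : realType}.
Local Notation mu := (@lebesgue_measure R).
Implicit Types (s t x y : R).

Definition gamma_kernel x t := t `^ (x - 1) * expR (- t).

Lemma gamma_kernel_ge0 x t : 0 <= gamma_kernel x t.
Proof. by rewrite mulr_ge0 ?powR_ge0 ?expR_ge0. Qed.

Lemma measurable_gamma_kernel x (D : set R) : measurable_fun D (gamma_kernel x).
Proof.
apply: measurable_funTS; apply: measurable_funM; first exact: measurable_powR.
apply: (measurableT_comp (@measurable_expR R)); apply: continuous_measurable_fun.
exact: opp_continuous.
Qed.

(** Extended values let the recursion be proved before finiteness is known. *)
Definition egamma x : \bar R := (\int[mu]_(t in `]0%R, +oo[) (gamma_kernel x t)%:E)%E.

(** Integration by parts with the primitive -t^x exp(-t), which vanishes at both ends. *)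
Lemma egammaD1 x : 0 < x -> egamma (x + 1) = (x%:E * egamma x)%E.
Proof.
move=> x0; rewrite /egamma -ge0_integralZl_EFin//; last 3 first.
- by move=> t _; rewrite lee_fin gamma_kernel_ge0.
- by apply/measurable_EFinP; exact: measurable_gamma_kernel.
- exact: ltW.
have ck (u : R) t : 0 < t -> {for t, continuous (gamma_kernel u)}.
  move=> t0; apply: cvgM; first exact: continuous_powR.
  apply: (@continuous_comp _ _ _ (fun t : R => - t) (@expR R)).
    by apply: cvgN.
  exact: continuous_expR.
have := @FTC_0y R (fun t => - (t `^ x * expR (- t))) (gamma_kernel (x + 1))
  (fun t => x * gamma_kernel x t) 0 0.
rewrite !adde0; apply.
- by move=> t _; exact: gamma_kernel_ge0.
- by move=> t _; rewrite mulr_ge0 ?gamma_kernel_ge0 ?ltW.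
- by move=> t t0; exact: ck.
- by move=> t t0; apply: cvgM; [exact: cvg_cst|exact: ck].
- move=> t t0; have d1 := is_derive1_powR x t0.
  apply: is_derive_eq; rewrite /GRing.scale/= /gamma_kernel addrK; ring.
- rewrite -[X in _ --> X]oppr0; apply: cvgN; rewrite -[X in _ --> X](mul0r (expR (- 0))).
  apply: cvgM; first exact: powR_cvg0.
  apply: cvg_at_right_filter.
  apply: (@continuous_comp _ _ _ (fun t : R => - t) (@expR R)).
    by apply: cvgN.
  exact: continuous_expR.
rewrite -[X in _ --> X]oppr0; apply: cvgN.
(* For t >= 1, t^x <= t^(n+1), and exp t >= t^(n+2) / C, so the primitive is at most C / t in
   absolute value. *)
pose n := Num.truncn x.
have xn : x <= n.+1%:R by apply: ltW; exact: truncnS_gt.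
pose C : R := n.+2`!%:R.
have hC : C / t @[t --> +oo] --> (0 : R).
  rewrite -(mulr0 C); apply: cvgM; first exact: cvg_cst.
  apply/(@gtr0_cvgV0 _ _ _ _ (fun t : R => t)); first exact: nbhs_pinfty_gt.
  exact: cvg_id.
apply: squeeze_cvgr hC; last exact: cvg_cst.
near=> t.
have t1 : 1 <= t by near: t; exact: nbhs_pinfty_ge.
have t0 : 0 < t by lra.
rewrite mulr_ge0 ?powR_ge0 ?expR_ge0//= expRN ler_pdivrMr ?expR_gt0//.
have xt : t `^ x <= t ^+ n.+1 by rewrite -powR_mulrn ?(ltW t0)//; exact: ler_powR.
apply: le_trans xt _; rewrite mulrAC ler_pdivlMr// -exprSr.
have C0 : 0 < C by rewrite /C ltr0n fact_gt0.
have := @expR_ge1Dxn R t n.+1 (ltW t0); rewrite -/C => h.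
rewrite -ler_pdivrMl// mulrC; lra.
Unshelve. all: by end_near. Qed.

Lemma integral_expRN : egamma 1 = 1%E.
Proof.
have cexp t : 0 < t -> {for t, continuous (fun t : R => expR (- t))}.
  move=> _; apply: (@continuous_comp _ _ _ (fun t : R => - t) (@expR R)).
    by apply: cvgN.
  exact: continuous_expR.
have -> : egamma 1 = (\int[mu]_(t in `]0%R, +oo[) (expR (- t))%:E + 0%:E)%E.
  rewrite adde0; apply: eq_integral => t _.
  by rewrite /gamma_kernel subrr powRr0 mul1r.
transitivity (\int[mu]_(t in `]0%R, +oo[) ((fun=> 0%R) t)%:E + 1%:E)%E; last first.
  by rewrite integral0 add0e.
apply: (@FTC_0y R (fun t => 1 - expR (- t)) (fun t => expR (- t)) (fun=> 0) 0 1).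
- by move=> t _; exact: expR_ge0.
- by [].
- exact: cexp.
- by move=> t _; exact: cst_continuous.
- by move=> t t0; apply: is_derive_eq; rewrite /GRing.scale/=; ring.
- rewrite -[X in _ --> X](subrr 1); apply: cvgB; first exact: cvg_cst.
  apply: cvg_at_right_filter; rewrite -[X in _ --> X]expR0 -[X in expR X]oppr0.
  apply: (@continuous_comp _ _ _ (fun t : R => - t) (@expR R)).
    by apply: cvgN.
  exact: continuous_expR.
- rewrite -[X in _ --> X]subr0; apply: cvgB; first exact: cvg_cst.
  exact: cvgr_expR.
Qed.

Lemma egamma_nat (n : nat) : egamma n.+1%:R = (n`!%:R)%:E.
Proof.
elim: n => [|n ih]; first exact: integral_expRN.
by rewrite -[n.+2%:R]natr1 egammaD1 ?ltr0n// ih -EFinM -natrM -factS.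
Qed.

(** The kernel is dominated by the one of exponent 1 for t <= 1 and by one of integer exponent
    beyond; both have known integrals. Every argument in [hilbert_weight] is at least 1. *)
Lemma egamma_fin_num x : 1 <= x -> egamma x \is a fin_num.
Proof.
move=> x1; have xn : x - 1 <= (Num.truncn (x - 1)).+1%:R by apply: ltW; exact: truncnS_gt.
set n := Num.truncn _ in xn.
rewrite ge0_fin_numE; last first.
  by apply: integral_ge0 => t _; rewrite lee_fin gamma_kernel_ge0.
apply: (@le_lt_trans _ _ (egamma 1 + egamma n.+2%:R)%E); last first.
  by rewrite integral_expRN egamma_nat -EFinD ltry.
rewrite /egamma -ge0_integralD//; last 4 first.
- by move=> t _; rewrite lee_fin gamma_kernel_ge0.
- by apply/measurable_EFinP; exact: measurable_gamma_kernel.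
- by move=> t _; rewrite lee_fin gamma_kernel_ge0.
- by apply/measurable_EFinP; exact: measurable_gamma_kernel.
apply: ge0_le_integral => //.
- by move=> t _; rewrite lee_fin gamma_kernel_ge0.
- by apply/measurable_EFinP; exact: measurable_gamma_kernel.
- by apply: emeasurable_funD; apply/measurable_EFinP; exact: measurable_gamma_kernel.
move=> t; rewrite /= in_itv/= andbT => t0.
rewrite -EFinD lee_fin /gamma_kernel -mulrDl ler_wpM2r ?expR_ge0// subrr powRr0.
have [t1|t1] := leP t 1.
  rewrite ler_wpDr ?powR_ge0// -[leRHS](powRr0 t); apply: ger_powR; last by lra.
  by rewrite t0.
rewrite ler_wpDl//; apply: ler_powR; first exact: ltW.
by rewrite -natr1; lra.
Qed.

Lemma EFin_Gamma x : 1 <= x -> (Gamma x)%:E = egamma x.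
Proof. by move=> x1; rewrite /Gamma /Rintegral fineK//; exact: egamma_fin_num. Qed.

Lemma GammaD1 x : 1 <= x -> Gamma (x + 1) = x * Gamma x.
Proof.
move=> x1; apply: EFin_inj; rewrite EFinM !EFin_Gamma//; last by lra.
by apply: egammaD1; lra.
Qed.

Lemma Gamma_nat (n : nat) : Gamma (n%:R + 1) = n`!%:R :> R.
Proof. by rewrite natr1 /Gamma /Rintegral -/(egamma _) egamma_nat. Qed.

Lemma Gamma_gt0 x : 1 <= x -> 0 < Gamma x.
Proof.
move=> x1; rewrite -lte_fin EFin_Gamma//.
have m12 : measurable (`]1%R, 2%R[%classic : set R) by [].
apply: (@lt_le_trans _ _ (\int[mu]_(t in `]1%R, 2%R[) (gamma_kernel x t)%:E)%E); last first.
  apply: ge0_subset_integral => //.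
  - by apply/measurable_EFinP; exact: measurable_gamma_kernel.
  - by move=> t _; rewrite lee_fin gamma_kernel_ge0.
  - by move=> t /=; rewrite !in_itv/= andbT => /andP[t1 _]; lra.
apply: (@lt_le_trans _ _ (\int[mu]_(t in `]1%R, 2%R[) (cst (expR (- 2))%:E t))%E).
  rewrite integral_cst//= lebesgue_measure_itv/= lte_fin ifT; last by lra.
  by rewrite -EFinB -EFinM lte_fin mulr_gt0 ?expR_gt0//; lra.
apply: ge0_le_integral => //.
- by move=> t _; rewrite lee_fin expR_ge0.
- by apply/measurable_EFinP; exact: measurable_gamma_kernel.
move=> t /=; rewrite in_itv/= => /andP[t1 t2].
rewrite lee_fin /gamma_kernel -[leLHS]mul1r; apply: ler_pM => //.
  by rewrite -[leLHS](powRr0 t); apply: ler_powR; lra.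
by rewrite ler_expR; lra.
Qed.

(** Gamma(n + b + 1) / (n! Gamma(b + 1)) is [binc (b + 1) n], and the other Gamma factors form
    Beta(n + k + 1, b + 1). As n + k is an integer, [Beta_nat] replaces the general Beta-Gamma
    relation. *)
Lemma hilbert_weightE (b : R) (n k : nat) : 0 <= b ->
  hilbert_weight b n k = binc (b + 1) n * Beta (n.+1%:R + k%:R) (b + 1).
Proof.
move=> b0; have b1 : 0 < b + 1 by lra.
have rise (m : nat) : Gamma (m%:R + b + 1) = m`!%:R * binc (b + 1) m * Gamma (b + 1).
  elim: m => [|m ih]; first by rewrite add0r binc0 fact0 !mul1r.
  have -> : m.+1%:R + b + 1 = (m%:R + b + 1) + 1 by rewrite -natr1; ring.
  have := ler0n R m => m0.
  rewrite (@GammaD1 (m%:R + b + 1)); last by lra.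
  rewrite ih bincS factS natrM.
  have : m.+1%:R != 0 :> R by rewrite pnatr_eq0.
  move: (Gamma _) (m`!%:R) (binc _ _) => G f c; rewrite -natr1 => mm; field.
  by rewrite ?natr1 ?nat1r pnatr_eq0.
have G0 : 0 < Gamma (b + 1) by apply: Gamma_gt0; lra.
have -> : n.+1%:R + k%:R = (n + k).+1%:R :> R by rewrite -natrD addSn.
rewrite Beta_nat// /hilbert_weight -natrD; move: (n + k)%N => m.
have m0 := ler0n R m.
have -> : m%:R + b + 2 = (m%:R + b + 1) + 1 by ring.
rewrite (@GammaD1 (m%:R + b + 1)); last by lra.
rewrite !Gamma_nat !rise.
have f0 j : 0 < j`!%:R :> R by rewrite ltr0n fact_gt0.
have := f0 n; have := f0 m; have := binc_gt0 m b1; move: G0.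
move: (Gamma _) (n`!%:R) (m`!%:R) (binc _ m) (binc _ n) => G x y u v G0 u0 y0 x0.
by field; rewrite !gt_eqF//=; lra.
Qed.

End gamma.

(** * The Hilbert operator on binomial functions *)

Section hilbert_operator.
Context {R : realType}.
Implicit Types (b g d t x y : R) (z : R[i]).

Lemma csum_real (u : nat -> R) (l : R) :
  series u @ \oo --> l -> csum (fun k => (u k)%:C) = l%:C.
Proof.
move=> ul; apply: csum_unique.
rewrite (_ : series _ = (fun n => (series u n)%:C)); first exact: cvgC_real.
by apply/funext => n; rewrite /series/= rmorph_sum.
Qed.

Lemma eq_csum (u v : nat -> R[i]) : u =1 v -> csum u = csum v.
Proof. by move=> /funext ->. Qed.

Lemma tameZ (c : nat -> R) (k : R) : tame c -> tame (fun n => k * c n).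
Proof. by move=> tc; apply: (tame_le (C := `|k|) tc) => n; rewrite normrM. Qed.

Lemma coefs_pws (c : nat -> R) : tame c -> coefs (pws c) = (fun k => (c k)%:C : R[i]^o).
Proof.
move=> tc; have h : is_power_series (pws c) (fun k => (c k)%:C : R[i]^o).
  by move=> z z1; exact: cvg_pws.
apply: (power_series_unique (f := pws c)) => //.
exact: (@getI _ [set a | is_power_series (pws c) a] _ h).
Qed.

(** The inner sum over the input coefficients is [gauss_sum] with s = n + 1 and t = b + 1. The
    scalar [k] will normalize the test function. *)
Lemma hilbert_op_binomial b g k z : 0 <= b -> 0 < g < b + 1 ->
  hilbert_op b (pws (fun n => k * binc g n)) z =
  pws (fun n => k * (binc (b + 1) n * Beta n.+1%:R (b + 1 - g))) z.
Proof.
move=> b0 gb; have /andP[g0 gb1] := gb.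
rewrite /hilbert_op coefs_pws; last exact/tameZ/tame_binc.
apply: eq_csum => n; congr (_ * _).
rewrite -(csum_real (u := fun j => k * binc (b + 1) n * (binc g j * Beta (n.+1%:R + j%:R) (b + 1)))).
  by apply: eq_csum => j; rewrite hilbert_weightE// -rmorphM; congr (_%:C); ring.
have := gauss_sum gb (ltr0Sn R n) => h.
rewrite (_ : series _ = (fun N => k * binc (b + 1) n *
   series (fun j => binc g j * Beta (n.+1%:R + j%:R) (b + 1)) N)).
  by rewrite mulrA; apply: cvgM h; exact: cvg_cst.
by apply/funext => N; rewrite /series/= mulr_sumr.
Qed.

(** If Beta(n + g, t) stood in place of Beta(n + 1, t), with g + t = b + 1, the binomial function
    would be an exact eigenfunction with eigenvalue [Beta g t]. *)
Lemma Beta_binc g t n : 0 < g -> 0 < t ->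
  binc (g + t) n * Beta (n%:R + g) t = Beta g t * binc g n.
Proof.
move=> g0 t0; elim: n => [|n ih]; first by rewrite !binc0 add0r mulr1 mul1r.
have n0 := ler0n R n; have ng0 : 0 < n%:R + g by lra.
have -> : n.+1%:R + g = n%:R + g + 1 by rewrite -natr1; ring.
have ngt0 : n%:R + g + t != 0 by rewrite gt_eqF//; lra.
have n10 : n%:R + 1 != 0 :> R by rewrite natr1 pnatr_eq0.
have alg (c y B e : R) : c * y = B * e ->
    c * ((g + t + n%:R) / n.+1%:R) * ((n%:R + g) / (n%:R + g + t) * y) =
    B * (e * ((g + n%:R) / n.+1%:R)).
  by move=> h; rewrite [RHS]mulrA -h -natr1; field; rewrite n10.
by rewrite BetaD1l// !bincS; exact: alg ih.
Qed.

(** Division by n + 1 is worth one unit of the exponent: [g] is raised to d + 1, and [binc_shift]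
    extracts the factor n / d + 1. *)
Lemma binc_div_le g d n : 0 < g -> 0 < d -> g <= d + 1 ->
  binc g n / n.+1%:R <= (d^-1 + 1) * binc d n.
Proof.
move=> g0 d0 gd; rewrite ler_pdivrMr ?ltr0n//.
apply: le_trans (binc_le n g0 gd) _; rewrite binc_shift//.
have := binc_gt0 n d0; move: (binc d n) => c c0.
rewrite mulrAC; apply: ler_wpM2r; first exact: ltW.
have d10 : 0 < d^-1 by rewrite invr_gt0.
by rewrite -natr1; have := ler0n R n; nra.
Qed.

(* Bounds the error coefficients relative to those of (1 - z)^(-d). *)
Definition hilbert_err b d (m : nat) : R :=
  m.+1%:R * (b + 1) * (b + 2) ^+ m.+1 * (b + 2) * (d^-1 + 1).

(** The output is k Beta(g, t) times the binomial function plus a series with coefficients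
    [binc g n * rho n]. Since [rho n] is O(1 / n), these are dominated by the coefficients of (1 -
    z)^(-d), whose sum at |z| bounds the error. *)
Lemma hilbert_op_lower b g d k (m : nat) z : 0 <= b -> 0 < g < b + 1 -> 0 < d ->
  g <= d + 1 -> g <= m.+1%:R -> 0 <= k -> normc z < 1 ->
  k * Beta g (b + 1 - g) *
    (normc (1 - z) `^ (- g) - hilbert_err b d m * (1 - normc z) `^ (- d)) <=
  normc (hilbert_op b (pws (fun n => k * binc g n)) z).
Proof.
move=> b0 gb d0 gd gm k0 z1; have /andP[g0 gb1] := gb.
rewrite hilbert_op_binomial//.
pose t := b + 1 - g; have t0 : 0 < t by rewrite /t; lra.
have gt : g + t = b + 1 by rewrite /t; ring.
have B0 := Beta_gt0 g0 t0; rewrite -/t.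
have r0 n : 0 < n%:R + g by have := ler0n R n; lra.
pose rho n : R := Beta n.+1%:R t / Beta (n%:R + g) t - 1.
have alg (c y B a x : R) : 0 < y -> c * y = B * a ->
    k * (c * x) = k * B * (a + a * (x / y - 1)).
  move=> y0 h; rewrite mulrBr mulr1 addrC subrK -mulrA; congr (_ * _).
  by rewrite [RHS]mulrA -h; field; rewrite gt_eqF.
have cE n : k * (binc (b + 1) n * Beta n.+1%:R t) =
    k * Beta g t * (binc g n + binc g n * rho n).
  by apply: alg; [exact: Beta_gt0|rewrite -Beta_binc// gt].
(* Here b + 2 replaces the 1 + t of [Beta_ratio]; it is larger because t < b + 1, and it frees the
   constant from [g]. *)
pose K := m.+1%:R * (b + 1) * (b + 2) ^+ m.+1 * (b + 2).
have K0 : 0 <= K by rewrite /K !mulr_ge0 ?exprn_ge0 ?ler0n//; lra.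
have rhoK n : `|rho n| <= K / n.+1%:R.
  have gt1 : 1 <= g + t by rewrite gt; lra.
  apply: le_trans (Beta_ratio n g0 t0 gm gt1) _.
  rewrite gt; apply: ler_wpM2r; first by rewrite invr_ge0.
  have m0 : 0 <= m.+1%:R :> R by rewrite ler0n.
  have p1 : (1 + t) ^+ m.+1 <= (b + 2) ^+ m.+1.
    by apply: lerXn2r; rewrite ?nnegrE; lra.
  have p0 : 0 <= (1 + t) ^+ m.+1 by rewrite exprn_ge0//; lra.
  rewrite /K; apply: ler_pM; [|lra| |lra].
    by rewrite !mulr_ge0//; lra.
  by apply: ler_wpM2l => //; rewrite mulr_ge0//; lra.
have d10 : 0 < d^-1 by rewrite invr_gt0.
have eC n : `|binc g n * rho n| <= hilbert_err b d m * binc d n.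
  have a0 := binc_gt0 n g0.
  rewrite normrM (gtr0_norm a0) /hilbert_err -/K -mulrA.
  apply: le_trans (ler_wpM2l (ltW a0) (rhoK n)) _.
  rewrite mulrCA; apply: ler_wpM2l => //; exact: binc_div_le.
have te : tame (fun n => binc g n * rho n).
  apply: (tame_le (C := hilbert_err b d m) (tame_binc d0)) => n.
  by rewrite (gtr0_norm (binc_gt0 _ d0)).
have tg := tame_binc g0.
rewrite (_ : (fun n => _) = (fun n => k * Beta g t * (binc g n + binc g n * rho n))); last first.
  exact/funext.
rewrite pwsZ ?pwsD//; last exact: tameD.
rewrite ComplexField.Normc.normcM normc_real.
have kB0 : 0 <= k * Beta g t by apply: mulr_ge0 => //; exact: ltW.
rewrite ger0_norm//; apply: ler_wpM2l => //.
rewrite -normc_binomial//.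
have z0 := normc_ge0 z.
have hb := @binomial_real R d (normc z) d0 ltac:(by rewrite z0 z1).
have up : normc (pws (fun n => binc g n * rho n) z) <=
    hilbert_err b d m * (1 - normc z) `^ (- d).
  apply: normc_pws_le => n.
  apply: (@le_trans _ _ (hilbert_err b d m * series (fun j => binc d j * normc z ^+ j) n)).
    rewrite /series/= mulr_sumr; apply: ler_sum => j _; rewrite mulrA.
    by apply: ler_wpM2r (eC j); exact: exprn_ge0.
  apply: ler_wpM2l; first by rewrite /hilbert_err mulr_ge0//; lra.
  rewrite -(cvg_lim (@Rhausdorff R) hb); apply: nondecreasing_cvgn_le.
    apply/nondecreasing_seqP => j; rewrite /series/= big_nat_recr//= lerDl.
    by apply: mulr_ge0; [exact/ltW/binc_gt0|exact: exprn_ge0].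
  by apply/cvg_ex; eexists; exact: hb.
have := le_normcD (pws (binc g) z + pws (fun n => binc g n * rho n) z)
  (- pws (fun n => binc g n * rho n) z).
rewrite addrK normcN => h; rewrite lerBlDr; apply: le_trans h _.
by rewrite lerD2l.
Qed.

End hilbert_operator.

(** * Integrals over the disk *)

Section disk_kernel.
Context {R : realType}.
Local Notation mu := (@lebesgue_measure R).
Implicit Types (a q x y w v : R) (u : R * R).

Definition disk2 : set (R * R) := [set u | unit_disk (u.1 +i* u.2)].

Definition disk_kernel q a u : R :=
  normc (1 - (u.1 +i* u.2)) `^ (- q) * (1 - normc (u.1 +i* u.2) ^+ 2) `^ a.

Lemma disk_kernel_ge0 q a u : 0 <= disk_kernel q a u.
Proof. by rewrite mulr_ge0 ?powR_ge0. Qed.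

Lemma disk2E x y : disk2 (x, y) <-> x ^+ 2 + y ^+ 2 < 1.
Proof.
have e : normc (x +i* y) ^+ 2 = x ^+ 2 + y ^+ 2 by rewrite sqr_normc.
rewrite -e -[X in _ <-> _ < X](expr1n _ 2) ltr_pXn2r// ?nnegrE//.
exact: normc_ge0.
Qed.

Lemma measurable_normc (f g : R * R -> R) :
  measurable_fun setT f -> measurable_fun setT g ->
  measurable_fun setT (fun u => normc (f u +i* g u)).
Proof.
move=> mf mg; apply: (measurableT_comp (f := @Num.sqrt R)).
  by apply: continuous_measurable_fun; exact: sqrt_continuous.
by apply: measurable_funD; exact: measurable_funX.
Qed.

Lemma measurable_disk2 : measurable disk2.
Proof.
have m := measurable_normc (@measurable_fst _ _ R R) (@measurable_snd _ _ R R).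
rewrite (_ : disk2 = setT `&` (fun u => normc (u.1 +i* u.2)) @^-1` `]-oo, 1[%classic).
  exact: m.
by apply/seteqP; split=> [u h|u [_]]; [split=> //|]; rewrite /= in_itv.
Qed.

Lemma measurable_disk_kernel q a (D : set (R * R)) : measurable_fun D (disk_kernel q a).
Proof.
apply: measurable_funTS; apply: measurable_funM.
  apply: (measurableT_comp (measurable_powR _)).
  apply: (eq_measurable_fun (fun u => normc ((1 - u.1) +i* (0 - u.2)))) => //.
  apply: measurable_normc; apply: measurable_funB => //; exact: measurable_cst.
apply: (measurableT_comp (measurable_powR _)).
apply: measurable_funB; first exact: measurable_cst.
by apply: measurable_funX; apply: measurable_normc.
Qed.

(** The logarithms of [v] and [w] differ by at most ln 2; the absolute value of [a] covers both
    signs. *)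
Lemma powR_comparable a v w : 0 < w -> w / 2 <= v -> v <= 2 * w ->
  2 `^ (- `|a|) * w `^ a <= v `^ a <= 2 `^ `|a| * w `^ a.
Proof.
move=> w0 wv vw; have v0 : 0 < v by lra.
have l2 : 0 < ln 2 :> R by rewrite ln_gt0//; lra.
have h1 : ln v <= ln 2 + ln w.
  by rewrite -lnM ?posrE// ler_ln ?posrE//; lra.
have h2 : ln w <= ln 2 + ln v.
  by rewrite -lnM ?posrE// ler_ln ?posrE//; lra.
have two : (2 == 0 :> R) = false by rewrite gt_eqF//; lra.
rewrite /powR (gt_eqF w0) (gt_eqF v0) two -!expRD !ler_expR.
have [a0|a0] := leP 0 a.
  have := ler_wpM2l a0 h1; have := ler_wpM2l a0 h2 => k1 k2.
  by rewrite ger0_norm//; apply/andP; split; lra.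
have := ler_wnM2l (ltW a0) h1; have := ler_wnM2l (ltW a0) h2 => k1 k2.
by rewrite ltr0_norm//; apply/andP; split; lra.
Qed.

Lemma powRN_anti q v w : 0 <= q -> 0 < v -> v <= w -> w `^ (- q) <= v `^ (- q).
Proof.
move=> q0 v0 vw; have w0 : 0 < w by lra.
rewrite !powRN lef_pV2 ?posrE ?powR_gt0//.
by apply: ge0_ler_powR => //; rewrite nnegrE; exact: ltW.
Qed.

(** In the triangle with vertex 1, |1 - z| <= 2 (1 - x), and 1 - |z|^2 lies within a factor 2 of 1 -
    x. *)
Lemma disk_kernel_lower q a x y : 0 <= q -> 0 < x < 1 -> `|y| <= (1 - x) / 2 ->
  2 `^ (- q) * 2 `^ (- `|a|) * (1 - x) `^ (a - q) <= disk_kernel q a (x, y).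
Proof.
move=> q0 /andP[x0 x1] yx; have w0 : 0 < 1 - x by lra.
have y2 : y ^+ 2 <= (1 - x) ^+ 2 / 4.
  rewrite -real_normK ?num_real//.
  have -> : (1 - x) ^+ 2 / 4 = ((1 - x) / 2) ^+ 2 by field.
  by apply: lerXn2r => //; rewrite nnegrE; lra.
have y20 := sqr_ge0 y.
rewrite /disk_kernel sqr_normc /=.
have N1 : normc (1 - (x +i* y)) <= 2 * (1 - x).
  apply: le_trans (normc_le_ReIm _) _; rewrite /= sub0r normrN (gtr0_norm w0); lra.
have N0 : 0 < normc (1 - (x +i* y)).
  have := le_Re_normc (1 - (x +i* y)); rewrite /= (gtr0_norm w0); lra.
have -> : (1 - x) `^ (a - q) = (1 - x) `^ (- q) * (1 - x) `^ a.
  by rewrite (addrC a) (@powRD _ _ (- q) a) ?(gt_eqF w0) ?implybT.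
rewrite mulrACA; apply: ler_pM; rewrite ?mulr_ge0 ?powR_ge0//.
  have two0 : 0 <= 2 :> R by lra.
  by rewrite -(powRM (- q) two0 (ltW w0)); apply: powRN_anti.
by have /andP[] := @powR_comparable a (1 - (x ^+ 2 + y ^+ 2)) (1 - x) w0 ltac:(nra) ltac:(nra).
Qed.

(** The slice of the triangle over [x] has length 1 - x, which leaves the integral of (1 -
    x)^(a-q+1), equal to 1 / (a + 2 - q). This is the blow-up as [q] tends to a + 2. *)
Lemma disk_kernel_integral_lower q a : -1 < a -> 0 <= q < a + 2 ->
  ((2 `^ (- q) * 2 `^ (- `|a|) / (a + 2 - q))%:E <=
   \int[mu \x mu]_(u in disk2) (disk_kernel q a u)%:E)%E.
Proof.
move=> a1 /andP[q0 qa]; rewrite integral_mkcond.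
set f := (X in (\int[_]_x X x)%E).
have f0 u : (0 <= f u)%E.
  by rewrite /f patchE; case: ifPn => // _; rewrite lee_fin disk_kernel_ge0.
have mf : measurable_fun setT f.
  have h : measurable_fun disk2 (EFin \o disk_kernel q a).
    by apply/measurable_EFinP; exact: measurable_disk_kernel.
  exact: (measurable_restrictT _ measurable_disk2).1 h.
rewrite fubini_tonelli1//.
have mF : measurable_fun setT (fubini_F mu f) by apply: measurable_fun_fubini_tonelli_F.
have F0 x : (0 <= fubini_F mu f x)%E by apply: integral_ge0.
apply: (@le_trans _ _ (\int[mu]_(x in `]0%R, 1%R[) fubini_F mu f x)%E); last first.
  by apply: ge0_subset_integral => //.
set c := 2 `^ (- q) * 2 `^ (- `|a|).
have c0 : 0 <= c by rewrite mulr_ge0 ?powR_ge0.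
apply: (@le_trans _ _ (\int[mu]_(x in `]0%R, 1%R[) (c%:E * ((1 - x) `^ (a - q + 1))%:E))%E).
  rewrite ge0_integralZl_EFin//.
  - rewrite integral_powR_left//; last by lra.
    by rewrite subr0 powR1 -EFinM lee_fin mul1r (_ : a - q + 1 + 1 = a + 2 - q)//; ring.
  - by move=> x _; rewrite lee_fin powR_ge0.
  - apply/measurable_EFinP/measurable_funTS; apply: (measurableT_comp (measurable_powR _)).
    by apply: measurable_funB => //; exact: measurable_cst.
apply: ge0_le_integral => //.
- by move=> x _; rewrite -EFinM lee_fin; apply: mulr_ge0 => //; exact: powR_ge0.
- apply: (@eq_measurable_fun _ _ _ _ _ (EFin \o (fun x => c * (1 - x) `^ (a - q + 1)))) => //.
  apply/measurable_EFinP/measurable_funTS; apply: measurable_funM => //.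
  apply: (measurableT_comp (measurable_powR _)).
  by apply: measurable_funB => //; exact: measurable_cst.
- exact: measurable_funTS.
move=> x /=; rewrite in_itv/= => /andP[x0 x1]; have w0 : 0 < 1 - x by lra.
rewrite /fubini_F.
pose h := (1 - x) / 2.
have sub : (\int[mu]_(y in `](- h)%R, h[) f (x, y) <= \int[mu]_y f (x, y))%E.
  apply: ge0_subset_integral => //; apply: measurableT_comp => //.
apply: le_trans sub.
apply: (@le_trans _ _ (\int[mu]_(y in `](- h)%R, h[) (cst (c * (1 - x) `^ (a - q))%:E y))%E).
  rewrite integral_cst//= lebesgue_measure_itv/= lte_fin ifT; last by rewrite /h; lra.
  rewrite -EFinB -!EFinM lee_fin -[leRHS]mulrA; apply: ler_wpM2l => //.
  rewrite (@powRD _ _ (a - q) 1) ?(gt_eqF w0) ?implybT// powRr1 ?(ltW w0)//.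
  by rewrite (_ : h - - h = 1 - x)// /h; field.
apply: ge0_le_integral => //.
- by move=> y _; rewrite lee_fin mulr_ge0 ?powR_ge0.
- by apply: measurable_funTS; apply: measurableT_comp.
move=> y /=; rewrite in_itv/= => /andP[y0 y1].
have yh : `|y| <= (1 - x) / 2 by rewrite ler_norml -/h; apply/andP; split; exact: ltW.
have uD : disk2 (x, y).
  apply/disk2E; have : y ^+ 2 <= h ^+ 2.
    by rewrite -real_normK ?num_real//; apply: lerXn2r => //; rewrite nnegrE /h; lra.
  rewrite /h; nra.
rewrite /f patchE mem_set// lee_fin; apply: disk_kernel_lower => //.
by rewrite x0 x1.
Qed.

End disk_kernel.

(** * Finiteness of the kernel integral, by horizontal slices *)

Section disk_kernel_finite.
Context {R : realType}.
Local Notation mu := (@lebesgue_measure R).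
Implicit Types (a b c q x y w v : R) (u : R * R).

Lemma measurable_powR_comp (f : R -> R) c (D : set R) :
  measurable_fun setT f -> measurable_fun D (fun x => f x `^ c).
Proof.
by move=> mf; apply: measurable_funTS; apply: (measurableT_comp (measurable_powR _)).
Qed.

Lemma integrable_powR_right a b c : a < b -> -1 < c ->
  mu.-integrable `]a, b[ (EFin \o (fun x => (x - a) `^ c)).
Proof.
move=> ab c1; apply/integrableP; split.
  apply/measurable_EFinP; apply: measurable_powR_comp.
  by apply: measurable_funB => //; exact: measurable_cst.
under eq_integral do rewrite /= ger0_norm ?powR_ge0//.
by rewrite integral_powR_right ?ltry.
Qed.

Lemma integrable_powR_left a b c : a < b -> -1 < c ->
  mu.-integrable `]a, b[ (EFin \o (fun x => (b - x) `^ c)).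
Proof.
move=> ab c1; apply/integrableP; split.
  apply/measurable_EFinP; apply: measurable_powR_comp.
  by apply: measurable_funB => //; exact: measurable_cst.
under eq_integral do rewrite /= ger0_norm ?powR_ge0//.
by rewrite integral_powR_left ?ltry.
Qed.

Lemma powR_le2 y c : 2^-1 <= y -> y <= 1 -> -1 <= c -> y `^ c <= 2.
Proof.
move=> y2 y1 c1; have y0 : 0 < y by lra.
apply: (@le_trans _ _ (y `^ (-1))).
  by apply: ger_powR => //; rewrite y0.
by rewrite powR_inv1 ?(ltW y0)// -[leRHS]invrK lef_pV2 ?posrE.
Qed.

Lemma mul_powR_le y c d : 0 < y < 1 -> -1 <= c -> -1 <= d ->
  y `^ c * (1 - y) `^ d <= 2 * (y `^ c + (1 - y) `^ d).
Proof.
move=> /andP[y0 y1] c1 d1; have p0 := powR_ge0 y c; have p1 := powR_ge0 (1 - y) d.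
have [y2|y2] := leP y 2^-1.
  have := @powR_le2 (1 - y) d ltac:(lra) ltac:(lra) d1; nra.
have := @powR_le2 y c ltac:(lra) ltac:(lra) c1; nra.
Qed.

(** Both w - x and |y| bound |1 - z| from below, and the exponent is shared between them. Moreover 1
    - |z|^2 = (w - x) (x + w), where x + w is comparable to [w] for x >= 0 and w - x is for x <
    0. *)
Lemma disk_kernel_upper q1 q2 a x y w : 0 <= q1 -> 0 <= q2 -> y != 0 -> 0 < w ->
  w ^+ 2 = 1 - y ^+ 2 -> - w < x < w ->
  disk_kernel (q1 + q2) a (x, y) <= `|y| `^ (- q2) * (2 `^ `|a| + 2 `^ `|a - q1|) *
    (w `^ a * (w - x) `^ (a - q1) + w `^ (a - q1) * (x + w) `^ a).
Proof.
move=> q10 q20 y0 w0 wE /andP[xw wx]; have w1 : w <= 1.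
  by rewrite leNgt; apply/negP => w1; have := sqr_ge0 y; nra.
have wx0 : 0 < w - x by lra. have wx1 : 0 < x + w by lra.
have ny0 : 0 < `|y| by rewrite normr_gt0.
rewrite /disk_kernel sqr_normc /=.
have -> : 1 - (x ^+ 2 + y ^+ 2) = (w - x) * (x + w).
  by rewrite opprD addrCA -wE; ring.
have N1 : w - x <= normc (1 - (x +i* y)).
  have h : 0 < 1 - x by lra.
  have := le_Re_normc (1 - (x +i* y)); rewrite /= (gtr0_norm h); lra.
have N2 : `|y| <= normc (1 - (x +i* y)).
  by have := le_Im_normc (1 - (x +i* y)); rewrite /= sub0r normrN.
have N0 : 0 < normc (1 - (x +i* y)) by lra.
have e1 : normc (1 - (x +i* y)) `^ (- (q1 + q2)) <= (w - x) `^ (- q1) * `|y| `^ (- q2).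
  rewrite opprD (@powRD _ _ (- q1) (- q2)) ?(gt_eqF N0) ?implybT//.
  by apply: ler_pM; rewrite ?powR_ge0//; apply: powRN_anti.
rewrite (powRM a (ltW wx0) (ltW wx1)).
apply: (@le_trans _ _ ((w - x) `^ (- q1) * `|y| `^ (- q2) * ((w - x) `^ a * (x + w) `^ a))).
  by apply: ler_wpM2r => //; rewrite mulr_ge0 ?powR_ge0.
have -> : (w - x) `^ (- q1) * `|y| `^ (- q2) * ((w - x) `^ a * (x + w) `^ a) =
    `|y| `^ (- q2) * ((w - x) `^ (a - q1) * (x + w) `^ a).
  rewrite (@powRD _ _ a (- q1)) ?(gt_eqF wx0) ?implybT//; ring.
rewrite -mulrA; apply: ler_wpM2l; first exact: powR_ge0.
have p1 := powR_ge0 (w - x) (a - q1); have p2 := powR_ge0 (x + w) a.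
have p3 := powR_ge0 w a; have p4 := powR_ge0 w (a - q1).
have p5 := powR_ge0 2 `|a|; have p6 := powR_ge0 2 `|a - q1|.
have [x0|x0] := leP 0 x.
  have /andP[_ h] := @powR_comparable R a (x + w) w w0 ltac:(lra) ltac:(lra).
  have : (w - x) `^ (a - q1) * (x + w) `^ a <= (w - x) `^ (a - q1) * (2 `^ `|a| * w `^ a).
    exact: ler_wpM2l.
  move=> /le_trans; apply.
  rewrite [leLHS](_ : _ = 2 `^ `|a| * (w `^ a * (w - x) `^ (a - q1))); last by ring.
  by apply: ler_pM; rewrite ?mulr_ge0 ?lerDl ?mulr_ge0.
have /andP[_ h] := @powR_comparable R (a - q1) (w - x) w w0 ltac:(lra) ltac:(lra).
have : (w - x) `^ (a - q1) * (x + w) `^ a <= (2 `^ `|a - q1| * w `^ (a - q1)) * (x + w) `^ a.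
  exact: ler_wpM2r.
move=> /le_trans; apply; rewrite -mulrA.
by apply: ler_pM; rewrite ?mulr_ge0 ?lerDr ?mulr_ge0.
Qed.

(** Integrating either term in [x] leaves w^(2a-q1+1); the exponent exceeds -1 and w <= 1, so w^(-1)
    bounds it. *)
Lemma disk_kernel_slice q1 q2 a y w : 0 <= q1 < a + 1 -> 0 <= q2 -> -1 < a -> y != 0 -> 0 < w ->
  w ^+ 2 = 1 - y ^+ 2 ->
  (\int[mu]_(x in `](- w)%R, w[) (disk_kernel (q1 + q2) a (x, y))%:E <=
   (`|y| `^ (- q2) * (2 `^ `|a| + 2 `^ `|a - q1|) *
     (2 `^ (a - q1 + 1) / (a - q1 + 1) + 2 `^ (a + 1) / (a + 1)) * w `^ (- 1))%:E)%E.
Proof.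
move=> /andP[q10 q1a] q20 a1 y0 w0 wE.
have w1 : w <= 1.
  by rewrite leNgt; apply/negP => w1; have := sqr_ge0 y; nra.
have nww : - w < w by lra.
set K := `|y| `^ (- q2) * (2 `^ `|a| + 2 `^ `|a - q1|).
have K0 : 0 <= K by rewrite mulr_ge0 ?addr_ge0 ?powR_ge0.
have il := @integrable_powR_left (- w) w (a - q1) nww ltac:(lra).
have ir := @integrable_powR_right (- w) w a nww a1.
pose g x := K * (w `^ a * (w - x) `^ (a - q1) + w `^ (a - q1) * (x - - w) `^ a).
have ig : mu.-integrable `](- w), w[ (EFin \o g).
  by apply: integrableRZ; apply: integrableRD; exact: integrableRZ.
apply: (@le_trans _ _ (\int[mu]_(x in `](- w)%R, w[) (g x)%:E)%E).
  apply: ge0_le_integral => //.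
  - by move=> x _; rewrite lee_fin disk_kernel_ge0.
  - apply: measurable_funTS; apply/measurable_EFinP.
    apply: (measurableT_comp (f := disk_kernel (q1 + q2) a)) => //.
    exact: measurable_disk_kernel.
  - by have /integrableP[] := ig.
  - by move=> x; rewrite /= in_itv/= => xw; rewrite lee_fin /g opprK; exact: disk_kernel_upper.
have fin : (\int[mu]_(x in `](- w)%R, w[) (g x)%:E)%E \is a fin_num.
  exact: integrable_fin_num ig.
rewrite -(fineK fin) lee_fin -/(Rintegral _ _ _).
rewrite RintegralZl//; last by apply: integrableRD; exact: integrableRZ.
rewrite RintegralD//; [|exact: integrableRZ..].
rewrite RintegralZl// RintegralZl//.
rewrite /Rintegral integral_powR_left//; last by lra.
rewrite integral_powR_right//= opprK.
have -> : w + w = 2 * w by ring.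
have two0 : 0 <= 2 :> R by lra.
rewrite !(powRM _ two0 (ltW w0)) -[leRHS]mulrA; apply: ler_wpM2l => //.
have wp e f : w `^ e * w `^ f = w `^ (e + f).
  by rewrite (@powRD _ _ e f) ?(gt_eqF w0) ?implybT.
have wl e : -1 <= e -> w `^ e <= w `^ (- 1) by move=> e1; apply: ger_powR => //; rewrite w0.
rewrite mulrDl; apply: lerD.
  have -> : w `^ a * (2 `^ (a - q1 + 1) * w `^ (a - q1 + 1) / (a - q1 + 1)) =
    2 `^ (a - q1 + 1) / (a - q1 + 1) * w `^ (a + (a - q1 + 1)).
    by rewrite -(wp a (a - q1 + 1)); ring.
  apply: ler_wpM2l; first by rewrite divr_ge0 ?powR_ge0//; lra.
  by apply: wl; lra.
have -> : w `^ (a - q1) * (2 `^ (a + 1) * w `^ (a + 1) / (a + 1)) =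
  2 `^ (a + 1) / (a + 1) * w `^ (a - q1 + (a + 1)).
  by rewrite -(wp (a - q1) (a + 1)); ring.
apply: ler_wpM2l; first by rewrite divr_ge0 ?powR_ge0//; lra.
by apply: wl; lra.
Qed.

Lemma disk_kernel_integral_finite q a : -1 < a -> 0 <= q < a + 2 ->
  (\int[mu \x mu]_(u in disk2) (disk_kernel q a u)%:E < +oo)%E.
Proof.
move=> a1 /andP[q0 qa].
(* Splitting [q] in the ratio a + 1 to 1 gives q1 < a + 1, needed to integrate in [x], and q2 < 1,
   needed for |y|^(-q2); both amount to q < a + 2. *)
pose q1 := q * (a + 1) / (a + 2); pose q2 := q / (a + 2).
have a20 : 0 < a + 2 by lra.
have q10 : 0 <= q1 by rewrite /q1 divr_ge0 ?mulr_ge0//; lra.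
have q20 : 0 <= q2 by rewrite /q2 divr_ge0//; lra.
have q21 : q2 < 1 by rewrite /q2 ltr_pdivrMr// mul1r.
have q1a : q1 < a + 1 by rewrite /q1 ltr_pdivrMr// mulrC ltr_pM2l//; lra.
have qE : q = q1 + q2 by rewrite /q1 /q2; field; rewrite gt_eqF.
have q1a' : 0 <= q1 < a + 1 by rewrite q10.
rewrite integral_mkcond.
set f := (X in (\int[_]_x X x)%E).
have f0 u : (0 <= f u)%E.
  by rewrite /f patchE; case: ifPn => // _; rewrite lee_fin disk_kernel_ge0.
have mf : measurable_fun setT f.
  have h : measurable_fun disk2 (EFin \o disk_kernel q a).
    by apply/measurable_EFinP; exact: measurable_disk_kernel.
  exact: (measurable_restrictT _ measurable_disk2).1 h.
rewrite fubini_tonelli2//.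
have mG : measurable_fun setT (fubini_G mu f) by apply: measurable_fun_fubini_tonelli_G.
have G0 y : (0 <= fubini_G mu f y)%E by apply: integral_ge0.
set C : R := (2 `^ `|a| + 2 `^ `|a - q1|) *
     (2 `^ (a - q1 + 1) / (a - q1 + 1) + 2 `^ (a + 1) / (a + 1)).
have C0 : 0 <= C.
  apply: mulr_ge0; apply: addr_ge0; rewrite ?powR_ge0// divr_ge0 ?powR_ge0//; lra.
pose D := 2 * C.
have D0 : 0 <= D by rewrite mulr_ge0.
have slice y : y != 0 -> `|y| < 1 ->
    (fubini_G mu f y <= (D * (`|y| `^ (- q2) + (1 - `|y|) `^ (- 2^-1)))%:E)%E.
  move=> y0 y1; have ny0 : 0 < `|y| by rewrite normr_gt0.
  have yy : 0 < 1 - y ^+ 2 by rewrite -real_normK ?num_real//; nra.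
  pose w := (1 - y ^+ 2) `^ (2^-1).
  have w0 : 0 < w by rewrite powR_gt0.
  have wE : w ^+ 2 = 1 - y ^+ 2.
    by rewrite -powR_mulrn ?ltW// -powRrM mulVf ?powRr1 ?ltW.
  have -> : fubini_G mu f y =
      (\int[mu]_(x in `](- w)%R, w[) (disk_kernel (q1 + q2) a (x, y))%:E)%E.
    rewrite /fubini_G [RHS]integral_mkcond; apply: eq_integral => x _.
    rewrite /f !patchE -qE; congr (if _ then _ else _).
    apply/idP/idP; rewrite !inE /= in_itv/=.
      move=> /disk2E h; apply/andP; split; nra.
    by move=> /andP[h1 h2]; apply/disk2E; nra.
  apply: le_trans (disk_kernel_slice q1a' q20 a1 y0 w0 wE) _.
  have wy : w `^ (- 1) <= (1 - `|y|) `^ (- 2^-1).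
    rewrite /w -powRrM mulrN1; apply: powRN_anti => //; first by lra.
    by rewrite -[y ^+ 2]real_normK ?num_real//; nra.
  rewrite lee_fin; set A := 2 `^ `|a| + _; set B := _ + 2 `^ (a + 1) / (a + 1).
  rewrite (_ : _ * w `^ (- 1) = C * (`|y| `^ (- q2) * w `^ (- 1))); last first.
    by rewrite /C -/A -/B; ring.
  rewrite [leRHS](_ : _ = C * (2 * (`|y| `^ (- q2) + (1 - `|y|) `^ (- 2^-1)))); last first.
    by rewrite /D; ring.
  apply: ler_wpM2l => //.
  have y01 : 0 < `|y| < 1 by rewrite ny0.
  have := @mul_powR_le `|y| (- q2) (- 2^-1) y01 ltac:(lra) ltac:(lra).
  by apply: le_trans; apply: ler_wpM2l => //; exact: powR_ge0.
(* The slice bound on each side of y = 0, with the differences spelled out to match the one-sided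
   power integrals. *)
pose g1 y := D * ((y - 0) `^ (- q2) + (1 - y) `^ (- 2^-1)).
pose g2 y := D * ((0 - y) `^ (- q2) + (y - - 1) `^ (- 2^-1)).
have N10 : - 1 < 0 :> R by lra.
have i1 : mu.-integrable `]0, 1[ (EFin \o g1).
  apply: integrableRZ; apply: integrableRD.
    by apply: integrable_powR_right; lra.
  by apply: integrable_powR_left; lra.
have i2 : mu.-integrable `](- 1), 0[ (EFin \o g2).
  apply: integrableRZ; apply: integrableRD.
    by apply: integrable_powR_left; lra.
  by apply: integrable_powR_right; lra.
have g10 y : 0 <= g1 y by rewrite mulr_ge0 ?addr_ge0 ?powR_ge0.
have g20 y : 0 <= g2 y by rewrite mulr_ge0 ?addr_ge0 ?powR_ge0.
pose h1 := (EFin \o g1) \_ `]0, 1[%classic.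
pose h2 := (EFin \o g2) \_ `](- 1), 0[%classic.
have mh1 : measurable_fun setT h1.
  by apply: (measurable_restrictT _ _).1 => //; have /integrableP[] := i1.
have mh2 : measurable_fun setT h2.
  by apply: (measurable_restrictT _ _).1 => //; have /integrableP[] := i2.
have h10 y : (0 <= h1 y)%E by rewrite /h1 patchE; case: ifPn => // _; rewrite lee_fin.
have h20 y : (0 <= h2 y)%E by rewrite /h2 patchE; case: ifPn => // _; rewrite lee_fin.
have mT0 : measurable ([set: R] `\ 0).
  by apply: measurableD => //; exact: measurable_set1.
(* The slice bound says nothing at y = 0, a null set. *)
rewrite -(@integral_setD1 _ _ 0 setT)//; last exact: measurable_funTS.
apply: (@le_lt_trans _ _ (\int[mu]_(y in [set: R] `\ 0%R) (h1 y + h2 y))%E).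
  apply: ge0_le_integral => //.
  - exact: measurable_funTS.
  - by apply: measurable_funTS; apply: emeasurable_funD.
  move=> y [_ /eqP y0].
  have [y1|y1] := ltP `|y| 1; last first.
    have -> : fubini_G mu f y = 0%E; last by rewrite adde_ge0.
    apply: integral0_eq => x _; rewrite /f patchE ifF//.
    apply/negP; rewrite inE => /disk2E; have := sqr_ge0 x => x2.
    by rewrite -[y ^+ 2]real_normK ?num_real//; nra.
  apply: le_trans (slice y y0 y1) _.
  have [yp|yn] := ltP 0 y.
    rewrite (gtr0_norm yp) in y1 *.
    apply: (@le_trans _ _ (h1 y)); last by rewrite leeDl.
    by rewrite /h1 patchE mem_set/= ?in_itv/= ?yp// lee_fin /g1 subr0.
  have yn0 : y < 0 by rewrite lt_neqAle y0.
  rewrite (ltr0_norm yn0) in y1 *.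
  apply: (@le_trans _ _ (h2 y)); last by rewrite leeDr.
  rewrite /h2 patchE mem_set/= ?in_itv/= ?yn0 ?andbT//; last by lra.
  have e : y - - 1 = 1 - - y by ring.
  by rewrite lee_fin /g2 sub0r e.
have le0 (h : R -> \bar R) : measurable_fun setT h -> (forall y, 0 <= h y)%E ->
    (\int[mu]_(y in [set: R] `\ 0%R) h y <= \int[mu]_y h y)%E.
  by move=> mh h0; apply: ge0_subset_integral => //.
rewrite ge0_integralD//; [|exact: measurable_funTS..].
apply: (@le_lt_trans _ _ (\int[mu]_y h1 y + \int[mu]_y h2 y)%E).
  by apply: leeD; exact: le0.
rewrite /h1 /h2 -!integral_mkcond.
by rewrite lte_add_pinfty//; [exact: integrable_lty i1|exact: integrable_lty i2].
Qed.

End disk_kernel_finite.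

(** * The operator norm *)

(** The integral of a nonnegative function is a supremum over simple functions below it, hence
    monotone without measurability. It is applied to |H_b f|^p, whose measurability is never
    established. *)
Lemma le_integral_ge0 d (T : measurableType d) (R : realType)
  (mu : {measure set T -> \bar R}) (D : set T) (f g : T -> \bar R) :
  (forall x, D x -> (0 <= f x)%E) -> (forall x, D x -> (f x <= g x)%E) ->
  (\int[mu]_(x in D) f x <= \int[mu]_(x in D) g x)%E.
Proof.
move=> f0 fg; rewrite !(integral_mkcond D).
have h x : (0 <= (f \_ D) x <= (g \_ D) x)%E.
  rewrite !patchE; case: ifPn => [/set_mem Dx|_]; last by rewrite lexx.
  by rewrite f0//= fg.
rewrite !ge0_integralTE; first last.
- by move=> x; have /andP[] := h x.
- by move=> x; have /andP[h0 h1] := h x; exact: le_trans h1.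
apply: ereal_sup_le => _ [s sf <-]; exists s => // x.
by apply: le_trans (sf x) _; have /andP[] := h x.
Qed.

Section test_functions.
Context {R : realType}.
Local Notation mu := (@lebesgue_measure R).
Implicit Types (alpha b p g d : R) (u : R * R).

Lemma bergman_normE alpha p (f : R[i] -> R[i]) :
  bergman_norm alpha p f = (((alpha + 1)%:E * ((pi^-1)%:E *
    \int[mu \x mu]_(u in disk2) (normc (f (u.1 +i* u.2)) `^ p *
      (1 - normc (u.1 +i* u.2) ^+ 2) `^ alpha)%:E)) `^ p^-1)%E.
Proof. by []. Qed.

Definition radial_kernel alpha c u : R :=
  (1 - normc (u.1 +i* u.2)) `^ (- c) * (1 - normc (u.1 +i* u.2) ^+ 2) `^ alpha.

Lemma radial_kernel_ge0 alpha c u : 0 <= radial_kernel alpha c u.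
Proof. by rewrite mulr_ge0 ?powR_ge0. Qed.

Lemma measurable_radial_kernel alpha c (D : set (R * R)) :
  measurable_fun D (radial_kernel alpha c).
Proof.
have m : measurable_fun setT (fun u : R * R => normc (u.1 +i* u.2)).
  by apply: measurable_normc.
apply: measurable_funTS; apply: measurable_funM; apply: (measurableT_comp (measurable_powR _)).
  by apply: measurable_funB => //; exact: measurable_cst.
by apply: measurable_funB; [exact: measurable_cst|exact: measurable_funX].
Qed.

(** As 1 - |z|^2 <= 2 (1 - |z|), the radial power is absorbed into the weight, whose exponent
    [alpha - c] stays above -1. *)
Lemma radial_kernel_finite alpha c : 0 <= c < alpha + 1 ->
  (\int[mu \x mu]_(u in disk2) (radial_kernel alpha c u)%:E < +oo)%E.
Proof.
move=> /andP[c0 ca].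
have ac : -1 < alpha - c by lra.
have h0 : 0 <= (0 : R) < alpha - c + 2 by rewrite lexx/=; lra.
have fin := disk_kernel_integral_finite ac h0.
apply: (@le_lt_trans _ _ ((2 `^ c)%:E * \int[mu \x mu]_(u in disk2) (disk_kernel 0 (alpha - c) u)%:E)%E); last first.
  by rewrite lte_mul_pinfty// lee_fin powR_ge0.
rewrite -ge0_integralZl_EFin; last 4 first.
- exact: measurable_disk2.
- by move=> u _; rewrite lee_fin disk_kernel_ge0.
- by apply/measurable_EFinP; exact: measurable_disk_kernel.
- exact: powR_ge0.
apply: le_integral_ge0 => u ud; first by rewrite lee_fin radial_kernel_ge0.
rewrite -EFinM lee_fin /radial_kernel /disk_kernel oppr0 powRr0 mul1r.
have r0 := normc_ge0 (u.1 +i* u.2); have r1 : normc (u.1 +i* u.2) < 1 by exact: ud.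
move: (normc _) r0 r1 => r r0 r1.
have w0 : 0 < 1 - r ^+ 2 by nra.
rewrite (@powRD _ _ alpha (- c)) ?(gt_eqF w0) ?implybT//.
rewrite [leRHS](_ : _ = (2 `^ c * (1 - r ^+ 2) `^ (- c)) * (1 - r ^+ 2) `^ alpha); last by ring.
apply: ler_wpM2r; first exact: powR_ge0.
have h1 : 1 - r ^+ 2 <= 2 * (1 - r) by nra.
have := powRN_anti c0 w0 h1; rewrite powRM; [|lra|lra].
rewrite powRN => /(ler_wpM2l (powR_ge0 2 c)); rewrite mulrA divff ?mul1r//.
Qed.

(* If [E G <= e F] then [K >= (1 - e) B F]; otherwise [F^p <= (E / e)^p G^p] and
   the left-hand side is nonpositive.  Used pointwise, this replaces Minkowski's
   inequality and needs no measurability of [K]. *)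
Lemma powR_sub_lower (K F G B E e p : R) : 0 <= K -> 0 <= F -> 0 <= G -> 0 <= B ->
  0 <= E -> 0 < e < 1 -> 0 < p -> B * (F - E * G) <= K ->
  ((1 - e) * B) `^ p * (F `^ p - (E / e) `^ p * G `^ p) <= K `^ p.
Proof.
move=> K0 F0 G0 B0 E0 /andP[e0 e1] p0 BK.
have e10 : 0 <= 1 - e by lra. have Ee0 : 0 <= E / e by rewrite divr_ge0// ltW.
have A0 := powR_ge0 ((1 - e) * B) p.
have [h|h] := leP (E * G) (e * F).
  apply: (@le_trans _ _ (((1 - e) * B) `^ p * F `^ p)).
    by apply: ler_wpM2l => //; rewrite gerBl mulr_ge0 ?powR_ge0.
  have h2 : (1 - e) * B * F <= K.
    by apply: le_trans BK; rewrite mulrAC mulrC; apply: ler_wpM2l => //; lra.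
  rewrite -powRM ?mulr_ge0//.
  by apply: ge0_ler_powR => //; [exact: ltW|rewrite nnegrE !mulr_ge0].
apply: (@le_trans _ _ 0); last exact: powR_ge0.
have FG : F <= E / e * G by rewrite mulrAC ler_pdivlMr// mulrC ltW.
rewrite mulr_ge0_le0// subr_le0 -powRM//.
by apply: ge0_ler_powR => //; [exact: ltW|rewrite nnegrE mulr_ge0].
Qed.

Definition binomial_fun g (k : R) : R[i] -> R[i] := pws (fun n => k * binc g n).

Lemma bergman_norm_test (alpha p g k : R) : -1 < alpha -> 0 < p -> 0 < g -> 0 <= k ->
  (bergman_norm alpha p (binomial_fun g k) =
   ((alpha + 1)%:E * ((pi^-1)%:E * ((k `^ p)%:E *
    \int[mu \x mu]_(u in disk2) (disk_kernel (g * p)%R alpha u)%:E))) `^ p^-1)%E.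
Proof.
move=> a1 p0 g0 k0; rewrite bergman_normE; congr ((_ * (_ * _)) `^ _)%E.
rewrite -ge0_integralZl_EFin; last 4 first.
- exact: measurable_disk2.
- by move=> u _; rewrite lee_fin disk_kernel_ge0.
- by apply/measurable_EFinP; exact: measurable_disk_kernel.
- exact: powR_ge0.
apply: eq_integral => u /set_mem ud; rewrite -EFinM; congr EFin.
rewrite /binomial_fun pwsZ//; last exact: tame_binc.
rewrite ComplexField.Normc.normcM normc_real ger0_norm// normc_binomial//.
by rewrite powRM ?powR_ge0// -powRrM mulNr -mulrA.
Qed.

Lemma bergman_space_test (alpha p g k : R) :
  0 < g -> (bergman_norm alpha p (binomial_fun g k) < +oo)%E ->
  bergman_space alpha p (binomial_fun g k).
Proof.
move=> g0 fin; split=> // z z1.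
have t : tame (fun n => k * binc g n) by exact/tameZ/tame_binc.
by have [] := is_derive_pws t z1.
Qed.

(** The hypothesis on [J] makes the error integral at most the fraction [e] of the main one. A
    factor (1 - e)^p comes from [powR_sub_lower] and another 1 - e from this hypothesis; the p-th
    root gives (1 - e)^((p+1)/p), which is at least (1 - e)^2. *)
Lemma opnorm_lower (alpha b p g d e J : R) (m : nat) :
  -1 < alpha -> 0 <= b -> 1 < p -> 0 < g -> g * p < alpha + 2 -> g < b + 1 ->
  0 < d -> g <= d + 1 -> g <= m.+1%:R -> 0 < e < 1 ->
  (\int[mu \x mu]_(u in disk2) (radial_kernel alpha (d * p) u)%:E <= J%:E)%E ->
  (hilbert_err b d m / e) `^ p * J / e <=
    2 `^ (- (g * p)) * 2 `^ (- `|alpha|) / (alpha + 2 - g * p) ->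
  (((1 - e) ^+ 2 * Beta g (b + 1 - g))%:E <=
     bergman_opnorm alpha p (hilbert_op b))%E.
Proof.
move=> a1 b0 p1 g0 gpa gb d0 gd gm e01 hJ big.
have /andP[e0 e1] := e01; have p0 : 0 < p by lra.
have e10 : 0 < 1 - e <= 1 by apply/andP; split; lra.
have e1ge0 : 0 <= 1 - e by lra.
have p10 : p + 1 != 0 by rewrite gt_eqF//; lra.
have pp2 : (p + 1) / p <= 2%:R by rewrite ler_pdivrMr//; lra.
have a10 : 0 <= alpha + 1 by lra.
have gp0 : 0 <= g * p by rewrite mulr_ge0// ltW.
have gp : 0 <= g * p < alpha + 2 by rewrite gp0.
set E := hilbert_err b d m in big *; set B := Beta g (b + 1 - g).
have t0 : 0 < b + 1 - g by lra.
have B0 : 0 < B by exact: Beta_gt0.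
have E0 : 0 <= E.
  by rewrite /E /hilbert_err !mulr_ge0 ?exprn_ge0 ?addr_ge0 ?invr_ge0// ltW.
have fin := disk_kernel_integral_finite a1 gp.
have low := disk_kernel_integral_lower a1 gp.
set Ig := (\int[mu \x mu]_(u in disk2) (disk_kernel (g * p) alpha u)%:E)%E in fin low.
have Ig0 : (0 <= Ig)%E by apply: integral_ge0 => u _; rewrite lee_fin disk_kernel_ge0.
have IgE : Ig = (fine Ig)%:E by rewrite fineK// ge0_fin_numE.
set I := fine Ig in IgE.
have Ilow : 2 `^ (- (g * p)) * 2 `^ (- `|alpha|) / (alpha + 2 - g * p) <= I.
  by move: low; rewrite IgE lee_fin.
have I0 : 0 < I.
  apply: lt_le_trans Ilow; rewrite divr_gt0 ?mulr_gt0 ?powR_gt0//; lra.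
pose N := (alpha + 1) * pi^-1.
have N0 : 0 < N by rewrite mulr_gt0 ?invr_gt0 ?pi_gt0//; lra.
have NI0 : 0 < N * I by rewrite mulr_gt0.
(* Chosen so that the test function has norm exactly 1. *)
pose k := (N * I) `^ (- p^-1).
have k0 : 0 < k by rewrite powR_gt0.
have kp : k `^ p = (N * I)^-1.
  by rewrite /k -powRrM mulNr mulVf ?gt_eqF// powR_inv1 ?ltW.
pose f := binomial_fun g k.
have nf : bergman_norm alpha p f = 1%E.
  rewrite /f bergman_norm_test ?(ltW k0)// -/Ig IgE kp -!EFinM poweR_EFin.
  have -> : (alpha + 1) * (pi^-1 * ((N * I)^-1 * I)) = (N * I) / (N * I).
    by move: ((N * I)^-1) => y; rewrite /N; ring.
  by rewrite divff ?powR1// gt_eqF.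
apply: (@le_trans _ _ (bergman_norm alpha p (hilbert_op b f))); last first.
  apply: ereal_sup_ubound; exists f => //; split; last by rewrite nf.
  by apply: bergman_space_test => //; rewrite -/f nf ltry.
rewrite bergman_normE.
set X := (\int[mu \x mu]_(u in disk2) _)%E.
pose A := ((1 - e) * (k * B)) `^ p; pose M := (E / e) `^ p.
have A0 : 0 <= A by exact: powR_ge0.
have M0 : 0 <= M by exact: powR_ge0.
pose jj u := A * (disk_kernel (g * p) alpha u - M * radial_kernel alpha (d * p) u).
(* The pointwise lower bound may be negative, while comparison with the nonmeasurable integrand
   needs a nonnegative minorant. *)
pose jp u := Num.max 0 (jj u).
have mj : measurable_fun disk2 jp.
  apply: measurable_maxr; first exact: measurable_cst.
  apply: measurable_funM; first exact: measurable_cst.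
  apply: measurable_funB; first exact: measurable_disk_kernel.
  by apply: measurable_funM; [exact: measurable_cst|exact: measurable_radial_kernel].
have jp0 u : 0 <= jp u by rewrite /jp le_max lexx.
have JX : (\int[mu \x mu]_(u in disk2) (jp u)%:E <= X)%E.
  apply: le_integral_ge0 => u ud; first by rewrite lee_fin.
  rewrite lee_fin ge_max mulr_ge0 ?powR_ge0//=.
  have gb' : 0 < g < b + 1 by rewrite g0.
  have hl := hilbert_op_lower b0 gb' d0 gd gm (ltW k0) ud.
  rewrite -/E -/B -/f in hl.
  have nz0 := normc_ge0 (u.1 +i* u.2).
  have kB0 : 0 <= k * B by rewrite mulr_ge0 ?ltW.
  have := powR_sub_lower (normc_ge0 _) (powR_ge0 _ _) (powR_ge0 _ _) kB0 E0 e01 p0 hl.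
  rewrite -/A -/M -!powRrM !mulNr => /(ler_wpM2r (powR_ge0 (1 - normc (u.1 +i* u.2) ^+ 2) alpha)).
  apply: le_trans; rewrite /jj /disk_kernel /radial_kernel.
  by rewrite le_eqVlt; apply/orP; left; apply/eqP; ring.
(* Kept additive, which avoids subtracting extended integrals. *)
have sum : (A%:E * Ig <= \int[mu \x mu]_(u in disk2) (jp u)%:E + (A * M * J)%:E)%E.
  have mD := measurable_disk2 (R := R).
  apply: (@le_trans _ _ (\int[mu \x mu]_(u in disk2) (jp u)%:E + (A * M)%:E *
      \int[mu \x mu]_(u in disk2) (radial_kernel alpha (d * p) u)%:E)%E); last first.
    apply: leeD => //; rewrite (EFinM (A * M)); apply: lee_wpmul2l => //.
    by rewrite lee_fin mulr_ge0.
  rewrite -!ge0_integralZl_EFin//; first last.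
  - by apply/measurable_EFinP; exact: measurable_disk_kernel.
  - by move=> u _; rewrite lee_fin disk_kernel_ge0.
  - by rewrite mulr_ge0.
  - by apply/measurable_EFinP; exact: measurable_radial_kernel.
  - by move=> u _; rewrite lee_fin radial_kernel_ge0.
  rewrite -ge0_integralD//; first last.
  - apply: (@eq_measurable_fun _ _ _ _ _ (EFin \o (fun u => A * M * radial_kernel alpha (d * p) u))) => //.
    apply/measurable_EFinP; apply: measurable_funM; first exact: measurable_cst.
    exact: measurable_radial_kernel.
  - move=> u _; apply: mule_ge0; rewrite lee_fin; last exact: radial_kernel_ge0.
    exact: mulr_ge0.
  - exact/measurable_EFinP.
  - by move=> u _; rewrite lee_fin.
  apply: le_integral_ge0 => u ud.
    by apply: mule_ge0; rewrite lee_fin// disk_kernel_ge0.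
  rewrite -!EFinM -EFinD lee_fin -lerBlDr.
  rewrite (_ : _ - _ = jj u); last by rewrite /jj; ring.
  by rewrite /jp le_max lexx orbT.
have key : (((1 - e) `^ (p + 1) * B `^ p)%:E <= (alpha + 1)%:E * (pi^-1%:E * X))%E.
  have MJ : M * J <= e * I.
    by rewrite (mulrC e) -ler_pdivrMr//; exact: le_trans big Ilow.
  apply: (@le_trans _ _ (N%:E * (A * (I - M * J))%:E)%E); last first.
    rewrite muleA -(EFinM (alpha + 1)); apply: lee_wpmul2l; first by rewrite lee_fin ltW.
    apply: le_trans JX; rewrite mulrBr EFinB leeBlDr//.
    by rewrite EFinM -IgE mulrA.
  rewrite -EFinM lee_fin /A !powRM ?mulr_ge0 ?(ltW k0) ?(ltW B0)//.
  rewrite kp (@powRD _ (1 - e) p 1) ?(negbTE p10)// (powRr1 e1ge0).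
  have P0 : 0 <= (1 - e) `^ p * B `^ p by rewrite mulr_ge0 ?powR_ge0.
  rewrite [leLHS](_ : _ = (1 - e) `^ p * B `^ p * (1 - e)); last by ring.
  rewrite [leRHS](_ : _ = (1 - e) `^ p * B `^ p * (1 - M * J / I)); last first.
    by field; rewrite !gt_eqF.
  apply: ler_wpM2l => //; rewrite lerD2l lerN2 ler_pdivrMr//.
have X0 : (0 <= X)%E.
  by apply: integral_ge0 => u _; rewrite lee_fin mulr_ge0 ?powR_ge0.
have := gt0_ler_poweR (r := p^-1) _ _ _ key.
rewrite poweR_EFin => h; apply: le_trans (h _ _ _); first last.
- by rewrite in_itv/= leey andbT !mule_ge0 ?lee_fin// invr_ge0 pi_ge0.
- by rewrite in_itv/= leey andbT lee_fin mulr_ge0 ?powR_ge0.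
- by rewrite invr_ge0 ltW.
rewrite lee_fin powRM ?powR_ge0// -!powRrM mulfV ?gt_eqF// powRr1 ?(ltW B0)//.
apply: ler_wpM2r; first exact: ltW.
rewrite -(powR_mulrn 2 e1ge0).
exact: ger_powR e10 _ _ pp2.
Qed.

End test_functions.

Lemma opnorm_approx (R : realType) (alpha b p e : R) :
  -1 < alpha -> 0 <= b -> 1 < p -> alpha + 2 < p * (b + 1) -> 0 < e < 1 ->
  (((1 - e) ^+ 2 * (Beta ((alpha + 2) / p) (b + 1 - (alpha + 2) / p) - e))%:E
     <= bergman_opnorm alpha p (hilbert_op b))%E.
Proof.
move=> a1 b0 p1 hpb e01; have /andP[e0 e1] := e01.
have p0 : 0 < p by lra.
have a20 : 0 < alpha + 2 by lra.
set s := (alpha + 2) / p; set t := b + 1 - s.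
have sp : s * p = alpha + 2 by rewrite divfK// gt_eqF.
have s0 : 0 < s by rewrite divr_gt0.
have sb : s < b + 1 by rewrite ltr_pdivrMr// mulrC.
have t0 : 0 < t by rewrite subr_gt0.
have t20 : 0 < t / 2 < t by apply/andP; split; lra.
(* The first entry only ensures d > 0. For the second, (s - 1) p = alpha + 2 - p < alpha + 1 because
   p > 1. *)
pose d := Num.max ((alpha + 1) / (2 * p)) (s - 1).
have d0 : 0 < d by rewrite lt_max divr_gt0//; lra.
have sd : s <= d + 1 by rewrite -lerBlDr le_max lexx orbT.
have dp : d * p < alpha + 1.
  rewrite maxr_pMl ?ltW// gt_max; apply/andP; split.
    have -> : (alpha + 1) / (2 * p) * p = (alpha + 1) / 2; last by lra.
    by field; rewrite gt_eqF.
  by rewrite mulrBl sp; lra.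
have dp01 : 0 <= d * p < alpha + 1 by rewrite dp mulr_ge0// ltW.
have fin := radial_kernel_finite dp01.
set Jb := (\int[_]_(_ in _) _)%E in fin.
have Jb0 : (0 <= Jb)%E by apply: integral_ge0 => u _; rewrite lee_fin radial_kernel_ge0.
have JE : Jb = (fine Jb)%:E by rewrite fineK// ge0_fin_numE.
have sm : s <= (Num.truncn s).+1%:R by apply: ltW; exact: truncnS_gt.
set m := Num.truncn s in sm.
set J := fine Jb in JE; have J0 : 0 <= J by exact: fine_ge0.
(* The threshold that the main integral must exceed; it is fixed before [g] is chosen. *)
pose L := (hilbert_err b d m / e) `^ p * J / e.
have L0 : 0 <= L.
  by rewrite /L; apply: divr_ge0; [apply: mulr_ge0 => //; exact: powR_ge0|exact: ltW].
(* A lower bound, uniform in g p <= alpha + 2, for the numerator of the blow-up. *)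
pose c := 2 `^ (- (alpha + 2)) * 2 `^ (- `|alpha|) : R.
have c0 : 0 < c by apply: mulr_gt0; apply: powR_gt0.
have Bt0 : 0 < Beta s (t - t / 2) by apply: Beta_gt0 => //; lra.
pose C := Beta s (t - t / 2) / (t / 2).
have C0 : 0 < C by apply: divr_gt0 => //; lra.
(* The three bounds keep [g] positive, make the loss in [Beta_lower] at most [e], and push the main
   integral above [L]. *)
pose h := Num.min (s / 2) (Num.min (e / (C + 1)) (c / (p * (L + 1)))).
have pL0 : 0 < p * (L + 1) by apply: mulr_gt0 => //; lra.
have h0 : 0 < h by rewrite !lt_min !divr_gt0//; lra.
have hs : h <= s / 2 by rewrite ge_min lexx.
have hC : h * C <= e.
  have : h <= e / (C + 1) by rewrite !ge_min lexx orbT.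
  rewrite ler_pdivlMr; last by lra.
  by apply: le_trans; apply: ler_wpM2l; [exact: ltW|lra].
have hL : L * (h * p) <= c.
  have : h <= c / (p * (L + 1)) by rewrite !ge_min lexx !orbT.
  rewrite ler_pdivlMr//; apply: le_trans.
  by rewrite mulrC -mulrA; apply: ler_wpM2l; [exact: ltW|apply: ler_wpM2l; [exact: ltW|lra]].
have hp0 : 0 < h * p by exact: mulr_gt0.
pose g := s - h.
have g0 : 0 < g by rewrite /g; lra.
have gp : alpha + 2 - g * p = h * p by rewrite -sp /g; ring.
have big : L <= 2 `^ (- (g * p)) * 2 `^ (- `|alpha|) / (alpha + 2 - g * p).
  rewrite gp ler_pdivlMr//; apply: le_trans hL _.
  apply: ler_wpM2r; first exact: powR_ge0.
  by apply: ler_powR; lra.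
apply: (@le_trans _ _ ((1 - e) ^+ 2 * Beta g (b + 1 - g))%:E); last first.
  have g1 : g * p < alpha + 2 by lra.
  have g2 : g < b + 1 by rewrite /g; lra.
  have g3 : g <= d + 1 by rewrite /g; lra.
  have g4 : g <= m.+1%:R by rewrite /g; lra.
  by apply: (opnorm_lower (d := d) (J := J) (m := m)); rewrite // -/Jb JE.
rewrite lee_fin; apply: ler_wpM2l; first exact: sqr_ge0.
have h0s : 0 <= h < s by apply/andP; split; lra.
have -> : b + 1 - g = t + h by rewrite /g /t; ring.
apply: le_trans (Beta_lower s0 t20 h0s); apply: lerB => //.
by rewrite mulrAC -mulrA.
Qed.

Theorem theorem3p2 (R : realType) (alpha b p : R)
  (halpha : -1 < alpha) (hb : 0 <= b) (hp : 1 < p)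
  (hpb : alpha + 2 < p * (b + 1)) :
  ((Beta ((alpha + 2) / p) (b + 1 - (alpha + 2) / p))%:E
     <= bergman_opnorm alpha p (hilbert_op b))%E.
Proof.
have p0 : 0 < p by lra.
have s0 : 0 < (alpha + 2) / p by apply: divr_gt0; lra.
have sb : (alpha + 2) / p < b + 1 by rewrite ltr_pdivrMr// mulrC.
have t0 : 0 < b + 1 - (alpha + 2) / p by lra.
have approx e := @opnorm_approx R alpha b p e halpha hb hp hpb.
have B0 := Beta_gt0 s0 t0.
move: (Beta _ _) B0 approx => B B0 approx.
apply/lee_addgt0Pr => eta eta0.
(* The loss in (1 - e)^2 (B - e) is e (1 + 2 B) up to a term of favourable sign, hence at most
   [eta]. *)
pose e := Num.min 2^-1 (eta / (1 + 2 * B)).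
have B2 : 0 < 1 + 2 * B by lra.
have e0 : 0 < e by rewrite lt_min divr_gt0// andbT invr_gt0.
have e2 : e <= 2^-1 by rewrite ge_min lexx.
have eeta : e * (1 + 2 * B) <= eta by rewrite -ler_pdivlMr// ge_min lexx orbT.
have e01 : 0 < e < 1 by apply/andP; split; lra.
apply: (@le_trans _ _ (((1 - e) ^+ 2 * (B - e))%:E + eta%:E)%E); last first.
  by apply: leeD => //; exact: approx.
rewrite -EFinD lee_fin.
have -> : (1 - e) ^+ 2 * (B - e) = B - e * (1 + 2 * B) + e ^+ 2 * (2 + B - e) by ring.
have : 0 <= e ^+ 2 * (2 + B - e) by apply: mulr_ge0; [exact: sqr_ge0|lra].
lra.
Qed.
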